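(* Assume that the functions $f_n:\mathbb{R}\to\mathbb{R}$, $n\ge 0$, satisfy the following three conditions: (i) the $f_n$ are eigenfunctions of the Fourier transform: $(\mathcal{F}f_n)(x)=(-\mathrm{i})^n f_n(x)$ for all $n\ge 0$ and $x\in\mathbb{R}$; (ii) $\{f_n\}_{n\ge 0}$ form an orthonormal set in $L_2(\mathbb{R})$, that is, $\int_{\mathbb{R}} f_n(x)f_m(x)\,\mathrm{d}x=\delta_{n,m}$; (iii) for every $n\ge 0$ we have $x^{-n-1}e^{x^2/2}f_n(x)\to 0$ as $|x|\to\infty$. Then for all $n\ge 0$ we have $f_n\equiv\psi_n$ or $f_n\equiv-\psi_n$.
   Context: The continuous Fourier transform is $(\mathcal{F}g)(x)=\frac{1}{\sqrt{2\pi}}\int_{\mathbb{R}}e^{-\mathrm{i}xy}g(y)\,\mathrm{d}y$. The Hermite functions are $\psi_n(x)=(-1)^n(\sqrt{\pi}\,2^n n!)^{-1/2}e^{x^2/2}\frac{\mathrm{d}^n}{\mathrm{d}x^n}e^{-x^2}$ for $n\ge 0$. *)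

(* Defs.v *)
From HB Require Import structures.
From mathcomp Require Import all_boot all_order all_algebra.
From mathcomp Require Import complex.
From mathcomp Require Import all_classical all_reals all_analysis.

Set Implicit Arguments.
Unset Strict Implicit.
Unset Printing Implicit Defensive.

Import Order.TTheory GRing.Theory Num.Theory.
Import numFieldNormedType.Exports.

Local Open Scope classical_set_scope.
Local Open Scope ring_scope.
Local Open Scope complex_scope.

Definition cexp (R : realType) (z : R[i]) : R[i] :=
  (expR (complex.Re z))%:C * (cos (complex.Im z) +i* sin (complex.Im z)).

(* [\int] in [ring_scope] is the real-valued Lebesgue integral [Rintegral],
   which is meaningful for integrable functions; for non-integrable ones it may
   return a default value. *)
Definition cintegral (R : realType) (g : R -> R[i]) : R[i] :=
  (\int[@lebesgue_measure R]_y complex.Re (g y))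
  +i* (\int[@lebesgue_measure R]_y complex.Im (g y)).

(* ['i%C] is [0 +i* 1]; an unannotated ['i] would be [Num.imaginary], which is
   only specified up to sign. *)
Definition fourier (R : realType) (g : R -> R[i]) (x : R) : R[i] :=
  ((Num.sqrt (2 * pi))^-1)%:C *
  cintegral (fun y : R => cexp (- 'i%C * x%:C * y%:C) * g y).

Definition hermite_function (R : realType) (n : nat) (x : R) : R :=
  (-1) ^+ n * (Num.sqrt (Num.sqrt pi * 2 ^+ n * n`!%:R))^-1
  * expR (x ^+ 2 / 2) * derive1n n (fun y : R => expR (- y ^+ 2)) x.

(* Main.v *)
Require Import Defs.
From HB Require Import structures.
From mathcomp Require Import all_boot all_order all_algebra.
From mathcomp Require Import complex.
From mathcomp Require Import all_classical all_reals all_analysis.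
From mathcomp Require Import measurable_realfun.
From mathcomp Require Import ring lra zify.

Set Implicit Arguments.
Unset Strict Implicit.
Unset Printing Implicit Defensive.

Import Order.TTheory GRing.Theory Num.Theory.
Import numFieldNormedType.Exports.

Local Open Scope classical_set_scope.
Local Open Scope ring_scope.
Local Open Scope complex_scope.

(** The core is a Hardy-type uncertainty principle, [hardy_eigenfunction]: an
eigenfunction f of the Fourier transform with |f x| <= C (1 + x^2)^M e^(-x^2/2)
is a polynomial times e^(-x^2/2).  The hypotheses provide such a bound for f_n:
decay makes f_n integrable, the eigenvalue equation then makes it bounded.
Once f_n = P_n e^(-x^2/2), decay forces deg P_n <= n, and orthonormality says
that the P_n are orthonormal for the weight e^(-x^2).  Two such families with
deg P_n <= n agree up to signs, so P_n is plus or minus the normalized Hermite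
polynomial ([orthonormal_herm]).

Hardy's theorem is usually proved by the Phragmen-Lindelof principle.  The
proof below replaces complex analysis by a statement about real sequences.  An
eigenfunction is even or odd, and satisfies
f(x) = s (2 pi)^(-1/2) \int trig(xy) f(y) dy, where s = 1 or s = -1 and trig is
cos (a = 0) or sin (a = 1).  Put
e_j = j! 2^(2j+a) / (2j+a)! \int x^(2j+a) e^(-x^2/2) f(x) dx and
A(t) = sum_j e_j t^j / j!.

- Gaussian moments show that e_j grows at most polynomially
  ([moment_coef_bound]).
- Pairing the eigenvalue equation with trig(bx) e^(-x^2/2) gives
  e^t A(-t) = s e^(-t) A(t).  The Taylor coefficients of e^(-t) A(t) are the
  iterated differences of e at 0, so every other one of them vanishes
  ([moment_coef_parity]).
- A sequence with these two properties has only finitely many nonzero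
  differences at 0 ([odd_flat_vanish]), that is, e_j is a polynomial in j.
- The normalized moments of the Hermite polynomial H_(2l+a) are proportional to
  the binomials C(j, l) ([herm_moment]).  Hence some polynomial q has the same
  moments e_j, the function f - q e^(-x^2/2) is orthogonal to all x^(2j+a)
  ([moments_vanish]), and f is the transform of q e^(-x^2/2), which is a
  polynomial times e^(-x^2/2).

For [odd_flat_vanish] let D be the difference operator.  The equation
(D^2 + tan^2 u) x = e has a solution x of polynomial growth, and x inherits from
e the vanishing of odd differences at 0 ([odd_flat_resolvent]); in particular
x_1 = x_0.  This makes sum_j e_j Re z^(j+1) telescope to 0 on the circle
z = cos u e^(iu) ([sum_zcos_small]), and integration in u gives
sum_(j >= 1) e_j cos^j u sin(ju) / j = e_0 (pi/2 - u) ([sinint_limit]).  Apply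
this to a = D^(2M+2) e in place of e.  Taking 2M+2 differences cancels the
singularity at z = 1, so the sums of a_j cos^j u cos(j th) remain bounded for
0 <= th <= u, uniformly in u ([trigsum_bound]).  Integrated in th from 0 to u
they bound |a_0| (pi/2 - u) by a constant times u, and u -> 0 gives a_0 = 0. *)

(** * Differences of polynomially growing sequences *)

Section Differences.
Context {R : realType}.
Implicit Types (e x y : nat -> R) (M : nat).

Definition fdiff e : nat -> R := fun j => e j.+1 - e j.

Definition poly_growth M (C : R) e := forall j, `|e j| <= C * j.+1%:R ^+ M.

(** Equivalently, the Newton series of [e] at 0 has even terms only, or the formal
    series e^(-t) sum_j e_j t^j / j! is even in t. *)
Definition odd_flat e := forall m, odd m -> iter m fdiff e 0 = 0.

Lemma iter_fdiff_lin (a b : R) x y m j :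
  iter m fdiff (fun i => a * x i + b * y i) j =
  a * iter m fdiff x j + b * iter m fdiff y j.
Proof.
elim: m x y j => [//|m IH] x y j.
rewrite !iterSr -IH; congr (iter m _ _ _).
by apply/funext => i; rewrite /fdiff; ring.
Qed.

Lemma odd_flat_lin (a b : R) x y :
  odd_flat x -> odd_flat y -> odd_flat (fun i => a * x i + b * y i).
Proof. by move=> fx fy m om; rewrite iter_fdiff_lin fx // fy // !mulr0 addr0. Qed.

Lemma odd_flat_fdiff2 x : odd_flat x -> odd_flat (fdiff (fdiff x)).
Proof. by move=> fx m om; rewrite -!iterSr fx //= om. Qed.

Lemma odd_flat_iter_fdiff m x : ~~ odd m -> odd_flat x -> odd_flat (iter m fdiff x).
Proof. by move=> em fx k ok; rewrite -iterD fx // oddD ok (negbTE em). Qed.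

Lemma poly_growth_fdiff M (C : R) e : 0 <= C -> poly_growth M C e ->
  poly_growth M ((1 + 2 ^+ M) * C) (fdiff e).
Proof.
move=> C0 be j; rewrite /fdiff; apply: le_trans (ler_normB _ _) _.
rewrite (_ : (1 + 2 ^+ M) * C * j.+1%:R ^+ M
  = C * (2 * j.+1%:R) ^+ M + C * j.+1%:R ^+ M); last by rewrite exprMn; ring.
rewrite lerD //; apply: le_trans (be j.+1) _; rewrite ler_wpM2l //.
by rewrite lerXn2r ?nnegrE ?mulr_ge0 // -natrM ler_nat mul2n -addnn; lia.
Qed.

Lemma poly_growth_iter_fdiff M (C : R) e m : 0 <= C -> poly_growth M C e ->
  poly_growth M ((1 + 2 ^+ M) ^+ m * C) (iter m fdiff e).
Proof.
move=> C0 be; elim: m => [|m IH]; first by rewrite expr0 mul1r.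
rewrite exprS -mulrA /=; apply: poly_growth_fdiff IH.
by rewrite mulr_ge0 // exprn_ge0 // addr_ge0 // exprn_ge0.
Qed.

Lemma eq0_norm_le_cvg0 (d : R) (u : R^nat) :
  u @ \oo --> (0 : R) -> (forall n, `|d| <= u n) -> d = 0.
Proof.
move=> u0 du; apply/eqP; rewrite -normr_eq0 eq_le normr_ge0 andbT.
by rewrite -(cvg_lim _ u0) //; apply: limr_ge; [apply/cvg_ex; exists 0|exact: nearW].
Qed.

(** Odd differences at 0 do not change from [x] to [x'], while the growth constant
    shrinks by [q]; after k steps they are bounded by a multiple of q^k. *)
Lemma flat_of_contraction M (q : R) (S : (nat -> R) -> Prop) : 0 <= q < 1 ->
  (forall C x, 0 <= C -> poly_growth M C x -> S x ->
     exists x', [/\ poly_growth M (q * C) x', S x' & odd_flat (fun j => x j - x' j)]) ->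
  forall C x, 0 <= C -> poly_growth M C x -> S x -> odd_flat x.
Proof.
move=> /andP[q0 q1] hS C x C0 bx Sx m om.
apply: (@eq0_norm_le_cvg0 _ (fun k => ((1 + 2 ^+ M) ^+ m * C) * q ^+ k)).
  rewrite -[X in _ --> X](mulr0 ((1 + 2 ^+ M) ^+ m * C)).
  by apply: cvgMr; apply: cvg_expr; rewrite ger0_norm.
move=> k; elim: k C C0 x bx Sx => [|k IH] C C0 x bx Sx.
  rewrite expr0 mulr1; have := poly_growth_iter_fdiff m C0 bx 0.
  by rewrite expr1n mulr1.
have [x' [bx' Sx' fx']] := hS _ _ C0 bx Sx.
have -> : iter m fdiff x 0 = iter m fdiff x' 0.
  have := fx' m om; rewrite (_ : (fun _ => _) = fun j => 1 * x j + (- 1) * x' j).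
    by rewrite iter_fdiff_lin mul1r mulN1r => /eqP; rewrite subr_eq0 => /eqP.
  by apply/funext => j; rewrite mul1r mulN1r.
have qC0 : 0 <= q * C by rewrite mulr_ge0.
by apply: le_trans (IH _ qC0 _ bx' Sx') _; rewrite exprS mulrA mulrACA mulrA mulrAC.
Qed.

End Differences.

(** * The resolvent of the second difference operator *)

Section CosinePowers.
Context {R : realType}.
Implicit Types (u : R) (j : nat).

(** [zcos] and [zsin] are the real and imaginary parts of z^j, where
    z = cos u e^(iu) = (1 + e^(2iu)) / 2 runs over the circle |z - 1/2| = 1/2. *)
Definition zcos u j := cos u ^+ j * cos (j%:R * u).
Definition zsin u j := cos u ^+ j * sin (j%:R * u).

Lemma zcos0 u : zcos u 0 = 1. Proof. by rewrite /zcos mul0r cos0 mulr1. Qed.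
Lemma zsin0 u : zsin u 0 = 0. Proof. by rewrite /zsin mul0r sin0 mulr0. Qed.

Lemma zcosS u j : zcos u j.+1 = cos u * (cos u * zcos u j - sin u * zsin u j).
Proof. by rewrite /zcos /zsin -natr1 mulrDl mul1r cosD exprS; ring. Qed.

Lemma zsinS u j : zsin u j.+1 = cos u * (cos u * zsin u j + sin u * zcos u j).
Proof. by rewrite /zcos /zsin -natr1 mulrDl mul1r sinD exprS; ring. Qed.

(** z and its conjugate are the roots of z^2 = cos^2 u (2z - 1). *)
Lemma zcos_rec u j : zcos u j.+2 = cos u ^+ 2 * (2 * zcos u j.+1 - zcos u j).
Proof.
rewrite !zcosS zsinS; have := cos2Dsin2 u => h.
have -> : sin u * (cos u * (cos u * zsin u j + sin u * zcos u j)) =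
  cos u ^+ 2 * (sin u * zsin u j) + cos u * (sin u ^+ 2 * zcos u j) by ring.
by rewrite (_ : sin u ^+ 2 = 1 - cos u ^+ 2); [ring|rewrite -h; ring].
Qed.

Lemma zsin_rec u j : zsin u j.+2 = cos u ^+ 2 * (2 * zsin u j.+1 - zsin u j).
Proof.
rewrite !zsinS zcosS; have := cos2Dsin2 u => h.
have -> : sin u * (cos u * (cos u * zcos u j - sin u * zsin u j)) =
  cos u ^+ 2 * (sin u * zcos u j) - cos u * (sin u ^+ 2 * zsin u j) by ring.
by rewrite (_ : sin u ^+ 2 = 1 - cos u ^+ 2); [ring|rewrite -h; ring].
Qed.

Lemma norm_cos_le1 (x : R) : `|cos x| <= 1.
Proof. by rewrite ler_norml cos_geN1 cos_le1. Qed.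

Lemma norm_sin_le1 (x : R) : `|sin x| <= 1.
Proof. by rewrite ler_norml sin_geN1 sin_le1. Qed.

Lemma norm_zcos u j : 0 <= cos u -> `|zcos u j| <= cos u ^+ j.
Proof.
by move=> c0; rewrite normrM ger0_norm ?exprn_ge0 // ler_piMr ?exprn_ge0 // norm_cos_le1.
Qed.

Lemma norm_zsin u j : 0 <= cos u -> `|zsin u j| <= cos u ^+ j.
Proof.
by move=> c0; rewrite normrM ger0_norm ?exprn_ge0 // ler_piMr ?exprn_ge0 // norm_sin_le1.
Qed.

Lemma cos_in01 u : 0 < u < pi / 2 -> 0 < cos u < 1.
Proof.
move=> /andP[u0 u1]; rewrite cos_gt0_pihalf /=; last first.
  by rewrite u1 andbT (lt_trans _ u0) // oppr_lt0 divr_gt0 // pi_gt0.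
have s0 : 0 < sin u by apply: sin_gt0_pihalf; rewrite u0.
rewrite lt_neqAle cos_le1 andbT; apply/eqP => c1.
by have := cos2Dsin2 u; have := exprn_gt0 2 s0; rewrite c1 expr1n; lra.
Qed.

End CosinePowers.

Section PowerSums.
Context {R : realType}.

Lemma subX_le (M : nat) (a b : R) : 0 <= b <= a ->
  a ^+ M.+1 - b ^+ M.+1 <= M.+1%:R * a ^+ M * (a - b).
Proof.
move=> /andP[b0 ba]; rewrite subrXX mulrC ler_wpM2r ?subr_ge0 //.
rewrite mulr_natl -[M.+1 in leRHS]card_ord -sumr_const; apply: ler_sum => i _.
have iM : (i <= M)%N by rewrite -ltnS.
rewrite -[M in leRHS](subnK iM) exprD ?subSS /=.
by rewrite ler_wpM2l ?exprn_ge0 ?lerXn2r ?nnegrE // (le_trans b0).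
Qed.

(** Abel summation: multiplying by 1 - r replaces (j+1)^(M+1) by
    (j+1)^(M+1) - j^(M+1) <= (M+1) (j+1)^M, which gives an induction on M. *)
Lemma sum_pow_geometric_le (M : nat) (r : R) : 0 <= r < 1 -> forall J,
  \sum_(j < J) j.+1%:R ^+ M * r ^+ j <= M`!%:R / (1 - r) ^+ M.+1.
Proof.
move=> /andP[r0 r1]; have r1' : 0 < 1 - r by rewrite subr_gt0.
elim: M => [|M IH] J.
  rewrite expr1 fact0 ler_pdivlMr //.
  under eq_bigr do rewrite expr0 mul1r.
  rewrite mulrC -[1 - r]opprB mulNr -subrX1 opprB.
  by rewrite lerBlDr lerDl exprn_ge0.
rewrite ler_pdivlMr ?exprn_gt0 // exprS mulrA -ler_pdivlMr ?exprn_gt0 //.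
apply: (@le_trans _ _ (\sum_(j < J) M.+1%:R * (j.+1%:R ^+ M * r ^+ j))); last first.
  by rewrite -mulr_sumr factS natrM -mulrA ler_wpM2l.
have key : forall K, (\sum_(j < K) j.+1%:R ^+ M.+1 * r ^+ j) * (1 - r) =
    \sum_(j < K) (j.+1%:R ^+ M.+1 - j%:R ^+ M.+1) * r ^+ j - K%:R ^+ M.+1 * r ^+ K.
  elim=> [|K IHK]; first by rewrite !big_ord0 mul0r expr0n mul0r subr0.
  by rewrite !big_ord_recr /= mulrDl IHK (exprS r); ring.
rewrite key; apply: (@le_trans _ _ (\sum_(j < J) (j.+1%:R ^+ M.+1 - j%:R ^+ M.+1) * r ^+ j)).
  by rewrite lerBlDr lerDl mulr_ge0 ?exprn_ge0.
apply: ler_sum => j _; rewrite mulrA ler_wpM2r ?exprn_ge0 //.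
apply: le_trans (subX_le _ _) _; first by rewrite ler0n ler_nat leqnSn.
by rewrite -natrB // subSnn mulr1.
Qed.

End PowerSums.

Section Resolvent.
Context {R : realType}.

(** With S the shift and z = cos u e^(iu), the operator D^2 + tan^2 u is
    S^2 - 2 S + cos^(-2) u, whose roots 1/z and its conjugate lie outside the unit
    disc.  Its inverse therefore expands in powers of S; the coefficients are
    cos u / sin u times Im z^(k+1), and decay geometrically. *)
Lemma resolvent (u : R) (M : nat) (C : R) e : 0 < u < pi / 2 -> 0 <= C ->
  poly_growth M C e ->
  exists x, poly_growth M (M`!%:R / (sin u * (1 - cos u) ^+ M.+1) * C) x /\
    forall j, fdiff (fdiff x) j + (sin u / cos u) ^+ 2 * x j = e j.
Proof.
move=> hu C0 be; have /andP[c0 c1] := cos_in01 hu.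
have s0 := sin_gt0_pihalf hu.
pose r k := cos u / sin u * zsin u k.+1.
have r_bnd k : `|r k| <= (sin u)^-1 * cos u ^+ k.
  rewrite /r normrM ger0_norm; last by rewrite divr_ge0 // ltW.
  apply: le_trans (ler_wpM2l _ (norm_zsin _ (ltW c0))) _; first by rewrite divr_ge0 // ltW.
  rewrite -mulrA mulrCA ler_wpM2l ?invr_ge0 ?(ltW s0) // -exprS.
  by apply: ler_wiXn2l; [exact: ltW|exact: ltW|lia].
pose X j := series (fun k => r k * e (j + k)%N).
pose K := M`!%:R / (sin u * (1 - cos u) ^+ M.+1) * C.
have term_le j k : `|r k * e (j + k)%N| <=
    (sin u)^-1 * C * j.+1%:R ^+ M * (k.+1%:R ^+ M * cos u ^+ k).
  rewrite normrM.
  have -> : (sin u)^-1 * C * j.+1%:R ^+ M * (k.+1%:R ^+ M * cos u ^+ k) =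
    (sin u)^-1 * cos u ^+ k * (C * (j.+1%:R * k.+1%:R) ^+ M) by rewrite exprMn; ring.
  apply: ler_pM => //; apply: le_trans (be _) _; rewrite ler_wpM2l //.
  by rewrite lerXn2r ?nnegrE ?mulr_ge0 // -natrM ler_nat; lia.
have norm_le j n : \sum_(0 <= k < n) `|r k * e (j + k)%N| <= K * j.+1%:R ^+ M.
  apply: (@le_trans _ _ (\sum_(0 <= k < n)
     (sin u)^-1 * C * j.+1%:R ^+ M * (k.+1%:R ^+ M * cos u ^+ k))).
    by apply: ler_sum => k _.
  rewrite -mulr_sumr big_mkord.
  apply: le_trans (ler_wpM2l _ (sum_pow_geometric_le M _ n)) _.
  - by rewrite !mulr_ge0 ?exprn_ge0 // invr_ge0 ltW.
  - by rewrite (ltW c0).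
  - rewrite /K le_eqVlt; apply/orP; left; apply/eqP.
    by field; rewrite gt_eqF ?exprn_gt0 ?subr_gt0 // gt_eqF.
have cX j : cvgn (X j).
  apply: normed_cvg; rewrite /normed_series_of /=; apply: nondecreasing_is_cvgn.
    by apply/nondecreasing_seqP => n; rewrite seriesSr lerDl.
  exists (K * j.+1%:R ^+ M) => _ [n _ <-]; exact: norm_le.
exists (fun j => limn (X j)); split.
  move=> j; apply: (@le_trans _ _ (limn (fun n => `|X j n|))).
    by rewrite lim_norm.
  apply: limr_le; first exact: is_cvg_norm.
  apply: nearW => n; apply: le_trans (norm_le j n).
  exact: ler_norm_sum.
move=> j.
(* The coefficients r_k solve the homogeneous recurrence, so each finite
   truncation of the equation holds exactly: the truncations are taken one and
   two terms longer at j + 1 and j as the shift lowers the index. *)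
have rrec k : r k.+2 = cos u ^+ 2 * (2 * r k.+1 - r k).
  by rewrite /r zsin_rec; ring.
have fin n : X j.+2 n - 2 * X j.+1 n.+1 + (cos u) ^- 2 * X j n.+2 = e j.
  rewrite /X /series /=; elim: n => [|n IH].
    rewrite big_nil !big_nat_recr //= !big_nil !addn0 addn1.
    have -> : r 1%N = cos u ^+ 2 * (2 * r 0%N) by rewrite /r zsin_rec zsin0 subr0; ring.
    have -> : r 0%N = cos u ^+ 2.
      by rewrite /r zsinS zsin0 zcos0 mulr0 add0r mulr1; field; rewrite gt_eqF.
    by field; rewrite gt_eqF.
  rewrite (big_nat_recr n) //= (big_nat_recr n.+1) //= (big_nat_recr n.+2) //= rrec -[RHS]IH.
  rewrite !addSn !addnS; field; by rewrite gt_eqF.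
have lim : X j.+2 n - 2 * X j.+1 n.+1 + (cos u) ^- 2 * X j n.+2 @[n --> \oo] -->
    limn (X j.+2) - 2 * limn (X j.+1) + (cos u) ^- 2 * limn (X j).
  apply: cvgD; first apply: cvgB; first exact: cX.
    by apply: cvgMr; rewrite (cvg_shiftS (X j.+1)); exact: cX.
  by apply: cvgMr; rewrite (cvg_shiftS (fun n => X j n.+1)) (cvg_shiftS (X j)); exact: cX.
have := cvg_lim _ lim; rewrite (_ : (fun n => _) = cst (e j)); last first.
  by apply/funext => n; rewrite fin.
rewrite lim_cst // => /(_ (@norm_hausdorff _ _)) ->.
rewrite /fdiff; have h := cos2Dsin2 u.
rewrite expr_div_n (_ : sin u ^+ 2 = 1 - cos u ^+ 2); last by rewrite -h; ring.
by field; rewrite gt_eqF.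
Qed.

End Resolvent.

Section ResolventFlat.
Context {R : realType}.
Implicit Types (M : nat) (C t : R) (e x : nat -> R).

Lemma poly_growth_lin M (a b C D : R) x y : poly_growth M C x -> poly_growth M D y ->
  poly_growth M (`|a| * C + `|b| * D) (fun j => a * x j + b * y j).
Proof.
move=> bx by_ j; apply: le_trans (ler_normD _ _) _; rewrite !normrM mulrDl -!mulrA.
by rewrite lerD // ler_wpM2l.
Qed.

Definition fdiff2_plus t x : nat -> R := fun j => fdiff (fdiff x) j + t * x j.

Lemma fdiff2_plus_lin t (a b : R) x y :
  fdiff2_plus t (fun j => a * x j + b * y j) = fun j => a * fdiff2_plus t x j + b * fdiff2_plus t y j.
Proof. by apply/funext => j; rewrite /fdiff2_plus /fdiff; ring. Qed.

Lemma odd_flat_fdiff2_plus t x : odd_flat x -> odd_flat (fdiff2_plus t x).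
Proof.
move=> fx; rewrite (_ : fdiff2_plus t x = fun j => 1 * fdiff (fdiff x) j + t * x j).
  by apply: odd_flat_lin => //; exact: odd_flat_fdiff2.
by apply/funext => j; rewrite mul1r.
Qed.

Lemma cos_lt_pihalf (u v : R) : 0 < u -> u <= v -> v < pi / 2 -> cos v <= cos u /\ sin u <= sin v.
Proof.
move=> u0 uv v2; have pi0 := pi_gt0 R.
have hu : u \in `[0, pi] by rewrite in_itv /= ltW //=; lra.
have hv : v \in `[0, pi] by rewrite in_itv /=; apply/andP; split; lra.
have cvu : cos v <= cos u.
  by move: uv; rewrite le_eqVlt => /orP[/eqP->//|uv]; rewrite ltW // ltr_cos.
split=> //.
have su : 0 < sin u by apply: sin_gt0_pihalf; apply/andP; split; lra.
have sv : 0 < sin v by apply: sin_gt0_pihalf; apply/andP; split; lra.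
have cv : 0 < cos v by apply: cos_gt0_pihalf; apply/andP; split; lra.
rewrite -(@ler_pXn2r _ 2%N) ?nnegrE ?(ltW su) ?(ltW sv) //.
have : cos v ^+ 2 <= cos u ^+ 2 by rewrite lerXn2r ?nnegrE // (le_trans (ltW cv)).
by have := cos2Dsin2 u; have := cos2Dsin2 v; lra.
Qed.

(** The bound of [resolvent] decreases as [u] grows, so its value at [u1] serves
    all larger angles.  A uniform bound is what fixes the step length in
    [odd_flat_resolvent]. *)
Lemma resolvent_bounded M (u1 : R) : 0 < u1 < pi / 2 ->
  exists2 K, 0 < K & forall u C e, u1 <= u < pi / 2 -> 0 <= C -> poly_growth M C e ->
    exists x, poly_growth M (K * C) x /\ fdiff2_plus ((sin u / cos u) ^+ 2) x = e.
Proof.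
move=> hu1; have /andP[u10 u12] := hu1.
have /andP[c0 c1] := cos_in01 hu1; have s0 := sin_gt0_pihalf hu1.
exists (M`!%:R / (sin u1 * (1 - cos u1) ^+ M.+1)).
  by rewrite divr_gt0 ?ltr0n ?fact_gt0 // mulr_gt0 // exprn_gt0 // subr_gt0.
move=> u C e /andP[uu u2] C0 be.
have hu : 0 < u < pi / 2 by rewrite u2 andbT (lt_le_trans u10).
have [x [bx ex]] := resolvent hu C0 be; exists x; split; last exact/funext.
have /andP[cu0 cu1] := cos_in01 hu; have su0 := sin_gt0_pihalf hu.
have [cc ss] := cos_lt_pihalf u10 uu u2.
move=> j; apply: le_trans (bx j) _; rewrite !ler_wpM2r ?exprn_ge0 //.
rewrite ler_wpM2l // lef_pV2 ?posrE ?mulr_gt0 ?exprn_gt0 ?subr_gt0 //.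
apply: ler_pM; [exact: ltW|by apply: exprn_ge0; lra|exact: ss|].
by rewrite lerXn2r ?nnegrE ?subr_ge0 ?(ltW c1) ?(ltW cu1) // lerD2l lerN2.
Qed.

Lemma tan_sqr_surj t : 0 < t -> exists2 u, 0 < u < pi / 2 & (sin u / cos u) ^+ 2 = t.
Proof.
move=> t0; exists (atan (Num.sqrt t)).
  by rewrite atan_ltpi2 andbT -[X in X < _]atan0 lt_atan // sqrtr_gt0.
by rewrite -/(tan _) atanK sqr_sqrtr // ltW.
Qed.

(** For [t] large compared with the norm of D^2, the map x |-> - D^2 x / t is a
    contraction, and x + D^2 x / t = (D^2 + t) x / t is flat. *)
Lemma odd_flat_large M t : 2 * (1 + 2 ^+ M) ^+ 2 <= t ->
  forall C x, 0 <= C -> poly_growth M C x -> odd_flat (fdiff2_plus t x) -> odd_flat x.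
Proof.
move=> ht; set b := (1 + 2 ^+ M) ^+ 2 in ht.
have b0 : 0 < b by rewrite exprn_gt0 // ltr_wpDr ?exprn_ge0.
have t0 : 0 < t by lra.
apply: (@flat_of_contraction _ _ 2^-1); first by apply/andP; split; lra.
move=> C x C0 bx fx; exists (fun j => - t^-1 * fdiff (fdiff x) j + 0 * x j); split.
- have := poly_growth_iter_fdiff 2 C0 bx; rewrite -/b /= => bb.
  move=> j; apply: le_trans (poly_growth_lin (- t^-1) 0 bb bx j) _.
  rewrite normr0 mul0r addr0 normrN gtr0_norm ?invr_gt0 //.
  rewrite ler_wpM2r ?exprn_ge0 // mulrA ler_wpM2r //.
  by rewrite mulrC ler_pdivrMr //; lra.
- rewrite fdiff2_plus_lin; apply: odd_flat_lin => //.
  rewrite (_ : fdiff2_plus t _ = fdiff (fdiff (fdiff2_plus t x))); first exact: odd_flat_fdiff2.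
  by apply/funext => j; rewrite /fdiff2_plus /fdiff; ring.
- rewrite (_ : (fun _ => _) = fun j => t^-1 * fdiff2_plus t x j + 0 * fdiff2_plus t x j).
    exact: odd_flat_lin.
  by apply/funext => j; rewrite /fdiff2_plus; field; rewrite gt_eqF.
Qed.

(** Descent from large [t] in steps of fixed length h = 1 / (2K), where K bounds
    the resolvents at all parameters above [t].  Suppose the result is known at
    s + h, let (D^2 + s) x be flat, and solve (D^2 + s + h) y = x.  Then
    (D^2 + s + h) (x - h y) = (D^2 + s) x, so that x - h y is flat, and
    x |-> h y is a contraction. *)
Lemma odd_flat_resolvent M t : 0 < t ->
  forall C x, 0 <= C -> poly_growth M C x -> odd_flat (fdiff2_plus t x) -> odd_flat x.
Proof.
move=> t0; set b : R := 2 * (1 + 2 ^+ M) ^+ 2.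
have [u1 hu1 tu1] := tan_sqr_surj t0.
have [K K0 hK] := resolvent_bounded M hu1.
pose h := (2 * K)^-1; have h0 : 0 < h by rewrite invr_gt0 mulr_gt0.
suff P n : forall s, t <= s -> b - n%:R * h <= s -> forall C x, 0 <= C -> poly_growth M C x ->
    odd_flat (fdiff2_plus s x) -> odd_flat x.
  have [n hn] : exists n : nat, b / h <= n%:R.
    by exists (Num.bound (b / h)); rewrite ltW // archi_boundP // divr_ge0 // ?ltW// mulr_gt0 // exprn_gt0 // ltr_wpDr ?exprn_ge0.
  apply: (P n) => //; move: hn; rewrite ler_pdivrMr // => hn; lra.
elim: n => [|n IH] s ts bs; first by apply: odd_flat_large; rewrite mul0r subr0 in bs.
have IHs : forall C x, 0 <= C -> poly_growth M C x -> odd_flat (fdiff2_plus (s + h) x) -> odd_flat x.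
  by apply: IH; [lra | move: bs; rewrite -natr1; lra].
apply: (@flat_of_contraction _ _ 2^-1); first by apply/andP; split; lra.
move=> C x C0 bx fx.
have [u hu tu] : exists2 u, u1 <= u < pi / 2 & (sin u / cos u) ^+ 2 = s + h.
  exists (atan (Num.sqrt (s + h))); last by rewrite -/(tan _) atanK sqr_sqrtr //; lra.
  rewrite atan_ltpi2 andbT -[u1]tanK; last first.
    by move: hu1 => /andP[? ?]; rewrite in_itv /=; apply/andP; split => //; have := pi_gt0 R; lra.
  rewrite le_atan //.
  have -> : tan u1 = Num.sqrt t.
    rewrite -tu1 sqrtr_sqr ger0_norm //.
    by have /andP[? ?] := cos_in01 hu1; rewrite divr_ge0 // ltW // sin_gt0_pihalf.
  by rewrite ler_sqrt; lra.
have [y [by_ ey]] := hK _ _ _ hu C0 bx; rewrite tu in ey.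
pose w := fun j => 1 * x j + - h * y j.
have fw : odd_flat w.
  apply: (IHs (`|1| * C + `|- h| * (K * C))).
  - by rewrite addr_ge0 ?mulr_ge0 // ltW.
  - exact: poly_growth_lin.
  - rewrite fdiff2_plus_lin ey (_ : (fun _ => _) = fdiff2_plus s x) //.
    by apply/funext => j; rewrite /fdiff2_plus; ring.
exists (fun j => 0 * x j + h * y j); split.
- move=> j; apply: le_trans (poly_growth_lin 0 h bx by_ j) _.
  rewrite normr0 mul0r add0r gtr0_norm // ler_wpM2r ?exprn_ge0 //.
  by rewrite mulrA ler_wpM2r // /h invfM -mulrA mulVf ?mulr1 // gt_eqF.
- rewrite (_ : fdiff2_plus s _ = fun j => 1 * fdiff2_plus s x j + (- 1) * fdiff2_plus s w j).
    by apply: odd_flat_lin => //; exact: odd_flat_fdiff2_plus.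
  by apply/funext => j; rewrite /fdiff2_plus /w /fdiff; ring.
- rewrite (_ : (fun _ => _) = w) //.
  by apply/funext => j; rewrite /w; ring.
Qed.

End ResolventFlat.

(** * Boundary values of the generating function *)

Section BoundaryValues.
Context {R : realType}.
Implicit Types (M J N : nat) (C u r th : R) (e : nat -> R).

Lemma cvg_pow_geometric M r : 0 <= r < 1 -> (fun J => J.+1%:R ^+ M * r ^+ J) @ \oo --> (0 : R).
Proof.
move=> hr; have /andP[r0 r1] := hr.
apply: cvg_series_cvg_0; apply: nondecreasing_is_cvgn.
  by apply/nondecreasing_seqP => n; rewrite seriesSr lerDl mulr_ge0 // exprn_ge0.
exists (M`!%:R / (1 - r) ^+ M.+1) => _ [n _ <-].
by rewrite /series /= big_mkord; exact: sum_pow_geometric_le.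
Qed.

(** Summation by parts: [zcos] is annihilated by the adjoint of D^2 + tan^2 u, so
    only boundary terms remain; the one at 0 is a multiple of x_1 - x_0. *)
Lemma sum_zcos_telescope u e x J : cos u != 0 ->
  fdiff2_plus ((sin u / cos u) ^+ 2) x = e -> x 1%N = x 0%N ->
  \sum_(j < J) e j * zcos u j.+1 =
  x J.+1 * zcos u J - (cos u) ^- 2 * x J * zcos u J.+1.
Proof.
move=> c0 <- x10; have h := cos2Dsin2 u.
have ht : (sin u / cos u) ^+ 2 = (cos u) ^- 2 - 1.
  rewrite expr_div_n (_ : sin u ^+ 2 = 1 - cos u ^+ 2); last by rewrite -h; ring.
  by rewrite mulrBl mul1r mulfV // expf_neq0.
elim: J => [|J IH].
  rewrite big_ord0 zcosS zsin0 zcos0 x10; field; exact: c0.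
by rewrite big_ord_recr /= IH /fdiff2_plus /fdiff ht (zcos_rec u J); field.
Qed.

(** The real part of sum_j e_j z^(j+1) vanishes on the circle z = cos u e^(iu).
    The rate of convergence has to be uniform in [u], because the sum is
    integrated over [u] in [sinint_limit]; the factor cos^2 u is there because the
    integrand carries cos^(-2) u. *)
Lemma sum_zcos_small M C e u1 : 0 <= C -> poly_growth M C e -> odd_flat e -> 0 < u1 < pi / 2 ->
  exists2 B, 0 <= B & forall u J, u1 <= u < pi / 2 ->
    `|\sum_(j < J.+3) e j * zcos u j.+1| <= cos u ^+ 2 * (B * (J.+1%:R ^+ M * cos u1 ^+ J)).
Proof.
move=> C0 be fe hu1; have [K K0 hK] := resolvent_bounded M hu1.
have /andP[u10 _] := hu1.
have [q q0 hq] : exists2 q : R, 0 <= q &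
    forall i J, (i <= J.+4)%N -> i.+1%:R <= q * J.+1%:R.
  (* The indices that occur are at most J + 4, and (J + 5) <= 5 (J + 1). *)
  exists 5%:R => // i J iJ; rewrite -natrM ler_nat.
  by apply: leq_trans (_ : J.+4.+1 <= _)%N => //; lia.
pose Y := K * C * q ^+ M.
have KC0 : 0 <= K * C by rewrite mulr_ge0 // ltW.
have Y0 : 0 <= Y by rewrite mulr_ge0 // exprn_ge0.
exists (2 * Y); first by rewrite mulr_ge0.
move=> u J /andP[uu u2]; have hu : 0 < u < pi / 2 by rewrite u2 andbT (lt_le_trans u10).
have /andP[c0 c1] := cos_in01 hu; have s0 := sin_gt0_pihalf hu.
have [cc _] := cos_lt_pihalf u10 uu u2.
have [|x [bx ex]] := hK u C e _ C0 be; first by rewrite uu u2.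
have fx : odd_flat x.
  apply: (@odd_flat_resolvent _ M ((sin u / cos u) ^+ 2) _ _ _ KC0 bx); last by rewrite ex.
  by rewrite exprn_gt0 // divr_gt0.
have x10 : x 1%N = x 0%N by have /eqP := fx 1%N isT; rewrite /= /fdiff subr_eq0 => /eqP.
rewrite (sum_zcos_telescope _ _ ex x10) ?gt_eqF //.
apply: le_trans (ler_normB _ _) _.
set X := Y * J.+1%:R ^+ M.
have xb i : (i <= J.+4)%N -> `|x i| <= X.
  move=> iJ; apply: le_trans (bx i) _; rewrite /X /Y -mulrA ler_wpM2l // -exprMn.
  by rewrite lerXn2r ?nnegrE ?mulr_ge0 //; exact: hq.
have cJ : cos u ^+ J <= cos u1 ^+ J by rewrite lerXn2r ?nnegrE // ?(le_trans (ltW c0)) // ltW.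
have X0 : 0 <= X by rewrite mulr_ge0 // exprn_ge0.
apply: (@le_trans _ _ (X * (cos u ^+ 2 * cos u ^+ J) + X * (cos u ^+ 2 * cos u ^+ J))).
  apply: lerD.
    rewrite normrM; apply: ler_pM => //; first by apply: xb; rewrite ltnS.
    apply: le_trans (norm_zcos _ (ltW c0)) _; rewrite -exprD.
    by apply: ler_wiXn2l; [exact: ltW|exact: ltW|rewrite add2n].
  rewrite normrM [in X in X * _ <= _]normrM [`|_ ^- 2|]ger0_norm ?invr_ge0 ?exprn_ge0 ?(ltW c0) // mulrAC mulrC.
  apply: ler_pM => //; [|exact: xb (leqnSn _)|].
    by rewrite mulr_ge0 // invr_ge0 exprn_ge0 // ltW.
  apply: le_trans (ler_wpM2l _ (norm_zcos _ (ltW c0))) _.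
    by rewrite invr_ge0 exprn_ge0 // ltW.
  have -> : cos u ^+ J.+4 = cos u ^+ 2 * (cos u ^+ 2 * cos u ^+ J) by rewrite -!exprD.
  by rewrite mulKf ?expf_neq0 // gt_eqF.
have -> : cos u ^+ 2 * (2 * Y * (J.+1%:R ^+ M * cos u1 ^+ J)) =
  (2 * X * cos u ^+ 2) * cos u1 ^+ J by rewrite /X; ring.
have -> : X * (cos u ^+ 2 * cos u ^+ J) + X * (cos u ^+ 2 * cos u ^+ J) =
  (2 * X * cos u ^+ 2) * cos u ^+ J by ring.
by rewrite ler_wpM2l // !mulr_ge0 ?exprn_ge0 // ltW.
Qed.

Lemma is_derive_sin_mul (k th : R) :
  is_derive th 1 (fun t => sin (k * t)) (k * cos (k * th)).
Proof.
have -> : (fun t => sin (k * t)) = sin \o (k \*: id) by [].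
by apply: is_derive_eq; rewrite /= /GRing.scale /= mulr1 mulrC.
Qed.

Lemma is_derive_zsin u j :
  is_derive u 1 (fun v => zsin v j.+1) (j.+1%:R * (cos u ^+ j * cos (j.+2%:R * u))).
Proof.
have -> : zsin ^~ j.+1 = (cos ^+ j.+1) * (fun t => sin (j.+1%:R * t)) :> (R -> R).
  by apply/funext => v; rewrite /zsin !fctE.
have := is_derive_sin_mul j.+1%:R u => ?.
apply: is_derive_eq; rewrite /GRing.scale /= fctE.
have -> : j.+2%:R * u = j.+1%:R * u + u by rewrite -[j.+2%:R]natr1 mulrDl mul1r.
by rewrite cosD exprS; ring.
Qed.

Lemma is_derive_sum_ord n (h : 'I_n -> R -> R) (dh : 'I_n -> R) (x : R) :
  (forall i, is_derive x 1 (h i) (dh i)) ->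
  is_derive x 1 (fun y => \sum_(i < n) h i y) (\sum_(i < n) dh i).
Proof.
move=> hd; have := is_derive_sum hd.
by rewrite (_ : \sum_(i < n) h i = fun y => \sum_(i < n) h i y) // fct_sumE.
Qed.

Lemma is_derive_scale (a x df : R) (f : R -> R) :
  is_derive x 1 f df -> is_derive x 1 (fun y => a * f y) (a * df).
Proof. exact: is_deriveZ. Qed.

Lemma MVT_le (f df : R -> R) (a b D : R) : a <= b ->
  (forall x : R, is_derive x 1 f (df x)) ->
  (forall x : R, a < x < b -> `|df x| <= D) -> `|f b - f a| <= D * (b - a).
Proof.
rewrite le_eqVlt => /predU1P[<-|ab] hd hD; first by rewrite !subrr normr0 mulr0.
have [|c cab ->] := @MVT R f df a b ab (fun x _ => hd x).
- by apply: derivable_within_continuous => x _; case: (hd x).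
- by rewrite normrM [`|b - a|]gtr0_norm ?subr_gt0 // ler_wpM2r ?subr_ge0 ?(ltW ab) // hD.
Qed.

(** Partial sums of Im sum_(j >= 1) e_j z^j / j at z = r e^(i th), the angular
    primitive of the sums [cossum]. *)
Definition sinint e r J th := \sum_(i < J) e i.+1 / i.+1%:R * (r ^+ i.+1 * sin (i.+1%:R * th)).

(** Along z = cos u e^(iu) the derivative in u of cos^j u sin(ju) / j is
    cos^(j-1) u cos((j+1) u), so the derivative of
    sum_(j >= 1) e_j cos^j u sin(ju) / j is cos^(-2) u times the sum of
    [sum_zcos_small], minus e_0.  The claim follows by integration from u1 to pi/2,
    where cos u = 0. *)
Lemma sinint_limit M C e u1 : 0 <= C -> poly_growth M C e -> odd_flat e -> 0 < u1 < pi / 2 ->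
  (fun J => sinint e (cos u1) J.+2 u1) @ \oo --> e 0%N * (pi / 2 - u1).
Proof.
move=> C0 be fe hu1; have [B B0 hB] := sum_zcos_small C0 be fe hu1.
have /andP[u10 u12] := hu1; have /andP[c0 c1] := cos_in01 hu1.
apply/subr_cvg0.
apply: (@norm_cvg0 _ _).
pose err J := B * (J.+1%:R ^+ M * cos u1 ^+ J) * (pi / 2 - u1).
have err0 : err @ \oo --> (0 : R).
  rewrite -[X in _ --> X](mul0r (pi / 2 - u1)); apply: cvgMl.
  rewrite -[X in _ --> X](mulr0 B); apply: cvgMr; apply: cvg_pow_geometric.
  by rewrite (ltW c0).
apply: (@squeeze_cvgr _ _ _ _ (cst 0) err); last 2 first.
- exact: cvg_cst.
- exact: err0.
apply: nearW => J; rewrite normr_ge0 /=.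
(* F is the difference of the two sides up to a constant: F (pi/2) = e_0 pi/2. *)
pose F u := (\sum_(i < J.+2) e i.+1 / i.+1%:R * zsin u i.+1) + e 0%N * u.
pose dF u := (\sum_(i < J.+2) e i.+1 / i.+1%:R * (i.+1%:R * (cos u ^+ i * cos (i.+2%:R * u)))) + e 0%N * 1.
have hF (x : R) : is_derive x 1 F (dF x).
  have h1 : is_derive x 1 (fun v => \sum_(i < J.+2) e i.+1 / i.+1%:R * zsin v i.+1)
      (\sum_(i < J.+2) e i.+1 / i.+1%:R * (i.+1%:R * (cos x ^+ i * cos (i.+2%:R * x)))).
    by apply: is_derive_sum_ord => i; apply: is_derive_scale; exact: is_derive_zsin.
  exact: is_deriveD h1 (is_derive_scale (e 0%N) (is_derive_id x 1)).
have := @MVT_le F dF u1 (pi / 2) (B * (J.+1%:R ^+ M * cos u1 ^+ J)) (ltW u12) hF.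
have -> : F (pi / 2) - F u1 = - (sinint e (cos u1) J.+2 u1 - e 0%N * (pi / 2 - u1)).
  rewrite /F big1 => [|i _]; last by rewrite /zsin cos_pihalf expr0n /= mul0r mulr0.
  by rewrite /sinint; under [X in _ = - (X - _)]eq_bigr do rewrite -/(zsin _ _); ring.
rewrite normrN; apply => u /andP[uu u2].
have hu : 0 < u < pi / 2 by rewrite u2 andbT (lt_trans u10).
have /andP[cu0 cu1] := cos_in01 hu.
have -> : dF u = cos u ^- 2 * \sum_(j < J.+3) e j * zcos u j.+1.
  rewrite big_ord_recl zcosS zcos0 zsin0 /= /dF mulrDr mulr_sumr addrC; congr (_ + _).
    by field; rewrite gt_eqF.
  apply: eq_bigr => i _; rewrite /zcos /bump /= !add1n !exprS.
  by field; rewrite gt_eqF //= addrC natr1 pnatr_eq0.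
rewrite normrM ger0_norm ?invr_ge0 ?exprn_ge0 ?(ltW cu0) // ler_pdivrMl ?exprn_gt0 //.
by apply: hB; rewrite (ltW uu).
Qed.

End BoundaryValues.

(** * Vanishing of high differences *)

Section Flatness.
Context {R : realType}.
Implicit Types (M J N : nat) (C u r th : R) (e : nat -> R).

Definition cossum e r th J := \sum_(j < J) e j * (r ^+ j * cos (j%:R * th)).
Definition sinsum e r th J := \sum_(j < J) e j * (r ^+ j * sin (j%:R * th)).

(** With z = r e^(i th) and D e the difference of e,
    z sum (D e)_j z^j = (1 - z) sum e_j z^j - e_0 up to the last term; this lemma
    and the next are the real and imaginary parts after division by e^(i th). *)
Lemma cossum_fdiff e r th J : r * cossum (fdiff e) r th J =
  (cos th - r) * cossum e r th J.+1 + sin th * sinsum e r th J.+1 - cos th * e 0%N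
  + r * (e J * (r ^+ J * cos (J%:R * th))).
Proof.
rewrite /cossum /sinsum; elim: J => [|J IH].
  by rewrite !big_ord_recr !big_ord0 /= !expr0 !mul0r cos0 sin0; ring.
rewrite big_ord_recr [in RHS]big_ord_recr [X in sin th * X]big_ord_recr /= mulrDr IH /fdiff.
have h := cos2Dsin2 th.
have -> : J.+1%:R * th = J%:R * th + th by rewrite -natr1 mulrDl mul1r.
rewrite cosD sinD (exprS r).
set cJ := cos (J%:R * th); set sJ := sin (J%:R * th).
transitivity ((cos th - r) * (\sum_(i < J.+1) e i * (r ^+ i * cos (i%:R * th)))
 + sin th * (\sum_(i < J.+1) e i * (r ^+ i * sin (i%:R * th))) - cos th * e 0%N
 + r * e J.+1 * r ^+ J * cJ * (cos th ^+ 2 + sin th ^+ 2)); first by rewrite h; ring.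
by ring.
Qed.

Lemma sinsum_fdiff e r th J : r * sinsum (fdiff e) r th J =
  (cos th - r) * sinsum e r th J.+1 - sin th * cossum e r th J.+1 + sin th * e 0%N
  + r * (e J * (r ^+ J * sin (J%:R * th))).
Proof.
rewrite /cossum /sinsum; elim: J => [|J IH].
  by rewrite !big_ord_recr !big_ord0 /= !expr0 !mul0r cos0 sin0; ring.
rewrite big_ord_recr [in RHS]big_ord_recr [X in sin th * X]big_ord_recr /= mulrDr IH /fdiff.
have h := cos2Dsin2 th.
have -> : J.+1%:R * th = J%:R * th + th by rewrite -natr1 mulrDl mul1r.
rewrite cosD sinD (exprS r).
set cJ := cos (J%:R * th); set sJ := sin (J%:R * th).
transitivity ((cos th - r) * (\sum_(i < J.+1) e i * (r ^+ i * sin (i%:R * th)))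
 - sin th * (\sum_(i < J.+1) e i * (r ^+ i * cos (i%:R * th))) + sin th * e 0%N
 + r * e J.+1 * r ^+ J * sJ * (cos th ^+ 2 + sin th ^+ 2)); first by rewrite h; ring.
by ring.
Qed.

(** The sums are O((1 - cos u)^(-M-1)), and sin^2 u = (1 - cos u) (1 + cos u). *)
Lemma trigsum_base M C e u th J : 0 <= C -> poly_growth M C e -> 0 < u < pi / 2 ->
  sin u ^+ (2 * M.+1) * `|cossum e (cos u) th J| <= C * M`!%:R * 2 ^+ M.+1 /\
  sin u ^+ (2 * M.+1) * `|sinsum e (cos u) th J| <= C * M`!%:R * 2 ^+ M.+1.
Proof.
move=> C0 be hu; have /andP[c0 c1] := cos_in01 hu; have s0 := sin_gt0_pihalf hu.
have gen (g : nat -> R) : (forall j, `|g j| <= 1) ->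
    `|\sum_(j < J) e j * (cos u ^+ j * g j)| <= C * (M`!%:R / (1 - cos u) ^+ M.+1).
  move=> g1; apply: le_trans (ler_norm_sum _ _ _) _.
  apply: (@le_trans _ _ (\sum_(j < J) C * (j.+1%:R ^+ M * cos u ^+ j))).
    apply: ler_sum => j _; rewrite normrM mulrA; apply: ler_pM => //.
    by rewrite normrM ger0_norm ?ler_piMr ?exprn_ge0 ?(ltW c0).
  by rewrite -mulr_sumr ler_wpM2l // sum_pow_geometric_le // (ltW c0).
have fin (y : R) : y <= C * (M`!%:R / (1 - cos u) ^+ M.+1) ->
    sin u ^+ (2 * M.+1) * y <= C * M`!%:R * 2 ^+ M.+1.
  move=> hy; rewrite exprM; have := cos2Dsin2 u => h.
  have -> : sin u ^+ 2 = (1 - cos u) * (1 + cos u).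
    by rewrite (_ : sin u ^+ 2 = 1 - cos u ^+ 2); [ring|rewrite -h; ring].
  rewrite exprMn; apply: (@le_trans _ _ (((1 - cos u) ^+ M.+1 * (1 + cos u) ^+ M.+1) *
     (C * (M`!%:R / (1 - cos u) ^+ M.+1)))).
    by rewrite ler_wpM2l // mulr_ge0 // exprn_ge0; lra.
  rewrite [leLHS](_ : _ = C * M`!%:R * (1 + cos u) ^+ M.+1); last first.
    by field; rewrite expf_neq0 // gt_eqF // subr_gt0.
  by rewrite ler_wpM2l ?mulr_ge0 // lerXn2r ?nnegrE; lra.
by split; apply: fin; [apply: (gen (fun j => cos (j%:R * th))) => j; exact: norm_cos_le1
                      |apply: (gen (fun j => sin (j%:R * th))) => j; exact: norm_sin_le1].
Qed.

(** By [cossum_fdiff] each difference multiplies the sums by 1 - z up to bounded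
    terms.  In the region r = cos u, 0 <= th <= u one has |1 - z| = O(sin u), so
    each difference saves one power of sin u in [trigsum_base], and after 2M+2
    of them the sums are bounded. *)
Lemma trigsum_bound M C e N : 0 <= C -> poly_growth M C e -> (N <= 2 * M.+1)%N ->
  exists B D : R, [/\ 0 <= B, 0 <= D & forall u th J, 0 < u < pi / 2 -> 2^-1 <= cos u ->
    0 <= th <= u ->
    sin u ^+ (2 * M.+1 - N) * `|cossum (iter N fdiff e) (cos u) th J|
      <= B + D * (J.+1%:R ^+ M * cos u ^+ J) /\
    sin u ^+ (2 * M.+1 - N) * `|sinsum (iter N fdiff e) (cos u) th J|
      <= B + D * (J.+1%:R ^+ M * cos u ^+ J)].
Proof.
move=> C0 be; elim: N => [|N IH] hN.
  exists (C * M`!%:R * 2 ^+ M.+1), 0; split=> //.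
    by rewrite !mulr_ge0 ?exprn_ge0.
  by move=> u th J hu _ _; rewrite mul0r addr0 subn0; exact: trigsum_base.
have [B [D [B0 D0 hBD]]] := IH (ltnW hN).
set a := iter N fdiff e in hBD.
set A := (1 + 2 ^+ M) ^+ N * C.
have A0 : 0 <= A by rewrite mulr_ge0 ?exprn_ge0 ?addr_ge0 ?exprn_ge0.
have ba : poly_growth M A a := poly_growth_iter_fdiff N C0 be.
exists (2 * (2 * B + `|a 0%N|)), (2 * (2 * D * 2 ^+ M + A)); split.
- by rewrite mulr_ge0 // addr_ge0 // mulr_ge0.
- by rewrite mulr_ge0 // addr_ge0 // mulr_ge0 ?exprn_ge0 // mulr_ge0.
move=> u th J hu cu /andP[th0 thu].
have /andP[c0 c1] := cos_in01 hu; have s0 := sin_gt0_pihalf hu; have /andP[u0 u2] := hu.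
have s1 : sin u <= 1 := sin_le1 u.
have [hC hS] := hBD u th J.+1 hu cu (introT andP (conj th0 thu)).
set L := (2 * M.+1 - N.+1)%N; have LE : (2 * M.+1 - N)%N = L.+1 by rewrite /L subnSK.
rewrite LE exprS in hC hS.
set W := J.+1%:R ^+ M * cos u ^+ J.
have W0 : 0 <= W by rewrite mulr_ge0 // exprn_ge0 // ltW.
have W1 : J.+2%:R ^+ M * cos u ^+ J.+1 <= 2 ^+ M * W.
  rewrite /W mulrA -exprMn; apply: ler_pM; rewrite ?exprn_ge0 ?(ltW c0) //.
    by rewrite lerXn2r ?nnegrE ?mulr_ge0 // -natrM ler_nat mul2n -addnn !addSn ltnS addnS ltnS leq_addr.
  by apply: ler_wiXn2l => //; exact: ltW.
have L1 : sin u ^+ L <= 1 by rewrite exprn_ile1 // ltW.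
have L0 : 0 <= sin u ^+ L by rewrite exprn_ge0 // ltW.
have [cth sth] : cos u <= cos th /\ `|sin th| <= sin u.
  move: th0; rewrite le_eqVlt => /predU1P[<-|th0].
    by rewrite sin0 normr0 cos0 cos_le1 ltW.
  have [? ?] := cos_lt_pihalf th0 thu u2; split => //.
  by rewrite ger0_norm // ltW // sin_gt0_pihalf // th0 (le_lt_trans thu).
have cths : `|cos th - cos u| <= sin u.
  rewrite ger0_norm ?subr_ge0 //; have := cos_le1 th; have := cos2Dsin2 u => h.
  have : cos u ^+ 2 <= cos u by rewrite -[leRHS]expr1; apply: ler_wiXn2l => //; exact: ltW.
  have : sin u ^+ 2 <= sin u by rewrite -[leRHS]expr1; apply: ler_wiXn2l => //; exact: ltW.
  by lra.
have core (X Y Z T G : R) : `|X| <= sin u -> `|Y| <= sin u -> `|Z| <= 1 -> `|G| <= 1 ->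
    cos u * T = X * cossum a (cos u) th J.+1 + Y * sinsum a (cos u) th J.+1 + Z * a 0%N
      + cos u * (a J * (cos u ^+ J * G)) ->
    sin u ^+ L * `|T| <= 2 * (2 * B + `|a 0%N|) + 2 * (2 * D * 2 ^+ M + A) * W.
  move=> hX hY hZ hG hT.
  (* The assumption cos u >= 1/2 allows division by r = cos u. *)
  have hT2 : `|T| <= 2 * `|cos u * T|.
    rewrite normrM ger0_norm ?(ltW c0) // mulrA ler_peMl //.
    by rewrite -ler_pdivrMl // mulr1.
  apply: le_trans (ler_wpM2l L0 hT2) _; rewrite mulrCA -!mulrA -mulrDr ler_wpM2l // {}hT.
  set P := `|cossum a (cos u) th J.+1| in hC; set Q := `|sinsum a (cos u) th J.+1| in hS.
  apply: (@le_trans _ _ (sin u ^+ L * (sin u * P + sin u * Q + `|a 0%N| + A * W))).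
    rewrite ler_wpM2l //.
    apply: le_trans (ler_normD _ _) _; apply: lerD; last first.
      rewrite mulrCA normrM /W mulrA; apply: ler_pM => //.
      rewrite !normrM [`|cos u|]ger0_norm ?(ltW c0) //.
      rewrite [`|cos u ^+ J|]ger0_norm ?exprn_ge0 ?(ltW c0) //.
      rewrite -[leRHS]mul1r; apply: ler_pM; rewrite ?mulr_ge0 ?exprn_ge0 ?(ltW c0) ?(ltW c1) //.
      by rewrite ler_piMr // exprn_ge0 // ltW.
    apply: le_trans (ler_normD _ _) _; apply: lerD; last first.
      by rewrite normrM ler_piMl.
    apply: le_trans (ler_normD _ _) _.
    by rewrite !normrM; apply: lerD; rewrite ler_wpM2r.
  have -> : sin u ^+ L * (sin u * P + sin u * Q + `|a 0%N| + A * W) =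
    (sin u * sin u ^+ L * P + sin u * sin u ^+ L * Q) + sin u ^+ L * (`|a 0%N| + A * W) by ring.
  apply: (@le_trans _ _ ((B + D * (2 ^+ M * W)) + (B + D * (2 ^+ M * W)) + (`|a 0%N| + A * W))).
    apply: lerD.
      by apply: lerD; [apply: le_trans hC _|apply: le_trans hS _]; rewrite lerD2l ler_wpM2l.
    by rewrite ler_piMl // addr_ge0 // mulr_ge0.
  by rewrite le_eqVlt; apply/orP; left; apply/eqP; ring.
split.
- apply: (core (cos th - cos u) (sin th) (- cos th) _ (cos (J%:R * th))) => //.
  + by rewrite normrN norm_cos_le1.
  + exact: norm_cos_le1.
  + by rewrite /= cossum_fdiff -/a; ring.
- apply: (core (- sin th) (cos th - cos u) (sin th) _ (sin (J%:R * th))) => //.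
  + by rewrite normrN.
  + exact: norm_sin_le1.
  + exact: norm_sin_le1.
  + by rewrite /= sinsum_fdiff -/a; ring.
Qed.

(** The derivative of [sinint] in th is [cossum] without its term of index 0. *)
Lemma sinint_small M C e u J : 0 <= C -> poly_growth M C e -> 0 < u < pi / 2 ->
  forall B, (forall th, 0 <= th <= u -> `|cossum e (cos u) th J.+1| <= B) ->
  `|sinint e (cos u) J u| <= (B + `|e 0%N|) * u.
Proof.
move=> C0 be /andP[u0 u2] B hB.
pose F t := sinint e (cos u) J t.
pose dF t := \sum_(i < J) e i.+1 / i.+1%:R * (cos u ^+ i.+1 * (i.+1%:R * cos (i.+1%:R * t))).
have hF (t : R) : is_derive t 1 F (dF t).
  apply: is_derive_sum_ord => i; do 2 apply: is_derive_scale; exact: is_derive_sin_mul.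
have := @MVT_le R F dF 0 u (B + `|e 0%N|) (ltW u0) hF.
have -> : F 0 = 0 by rewrite /F /sinint big1 // => i _; rewrite mulr0 sin0 !mulr0.
rewrite !subr0; apply => t /andP[t0 tu].
have -> : dF t = cossum e (cos u) t J.+1 - e 0%N.
  rewrite /cossum big_ord_recl /= expr0 mul0r cos0 !mulr1 addrC addKr.
  by apply: eq_bigr => i _; rewrite /bump /= add1n; field; rewrite addrC natr1 pnatr_eq0.
by apply: le_trans (ler_normB _ _) _; rewrite lerD2r hB // !ltW.
Qed.

(** For a = D^(2M+2) e, [sinint_limit] and [trigsum_bound] evaluate and estimate the
    same sums, and give |a_0| (pi/2 - u) <= (B + |a_0|) u with B independent of
    u. *)
Theorem odd_flat_vanish M C e : 0 <= C -> poly_growth M C e -> odd_flat e ->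
  iter (2 * M.+1) fdiff e 0 = 0.
Proof.
move=> C0 be fe; set a := iter (2 * M.+1) fdiff e.
have [B [D [B0 D0 hBD]]] := trigsum_bound C0 be (leqnn _).
rewrite subnn -/a in hBD.
set A := (1 + 2 ^+ M) ^+ (2 * M.+1) * C.
have A0 : 0 <= A by rewrite mulr_ge0 ?exprn_ge0 ?addr_ge0 ?exprn_ge0.
have ba : poly_growth M A a := poly_growth_iter_fdiff _ C0 be.
have fa : odd_flat a by apply: odd_flat_iter_fdiff fe; rewrite oddM.
have pi0 := pi_gt0 R.
have main u : 0 < u <= pi / 4 -> `|a 0%N| * (pi / 2 - u) <= (B + `|a 0%N|) * u.
  move=> /andP[u0 u4]; have u2 : u < pi / 2 by lra.
  have hu : 0 < u < pi / 2 by rewrite u0.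
  have /andP[c0 c1] := cos_in01 hu.
  have cu : 2^-1 <= cos u.
    have : 0 <= cos (u + u) by apply: cos_ge0_pihalf; apply/andP; split; lra.
    rewrite cosD -!expr2; have := cos2Dsin2 u.
    have : cos u ^+ 2 <= cos u by rewrite -[leRHS]expr1; apply: ler_wiXn2l => //; exact: ltW.
    by lra.
  have lim1 : `|sinint a (cos u) J.+2 u| @[J --> \oo] --> `|a 0%N * (pi / 2 - u)|.
    by apply: cvg_norm; exact: sinint_limit A0 ba fa hu.
  pose G J := (B + D * (J.+1%:R ^+ M * cos u ^+ J) + `|a 0%N|) * u.
  have lim2 : G J @[J --> \oo] --> (B + D * 0 + `|a 0%N|) * u.
    apply: cvgMl; apply: cvgD; last exact: cvg_cst.
    apply: cvgD; first exact: cvg_cst.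
    by apply: cvgMr; apply: cvg_pow_geometric; rewrite (ltW c0).
  have lim3 : G J.+3 @[J --> \oo] --> (B + D * 0 + `|a 0%N|) * u.
    by rewrite (cvg_shiftS (fun J => G J.+2)) (cvg_shiftS (fun J => G J.+1)) (cvg_shiftS G).
  have := ler_cvg_to lim1 lim3.
  rewrite mulr0 addr0 normrM [`|_ - u|]ger0_norm ?subr_ge0 ?(ltW u2) //; apply.
  apply: nearW => J; apply: (sinint_small A0 ba hu) => th hth.
  have [+ _] := hBD u th J.+3 hu cu hth.
  by rewrite expr0 mul1r.
apply/eqP; rewrite -normr_eq0; apply/eqP.
apply/le_anti; rewrite normr_ge0 andbT; set x := `|a 0%N| in main *.
have x0 : 0 <= x := normr_ge0 _.
rewrite leNgt; apply/negP => xp.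
(* Small enough that (B + |a_0|) u < |a_0| (pi/2 - u). *)
pose u := Num.min (pi / 4) (x * pi / (4 * (B + 2 * x))).
have d0 : 0 < 4 * (B + 2 * x) by lra.
have u0 : 0 < u.
  by rewrite lt_min; apply/andP; split; apply: divr_gt0 => //; exact: mulr_gt0.
have := main u; rewrite u0 ge_min lexx /= => /(_ isT) h.
have : u * (4 * (B + 2 * x)) <= x * pi.
  by rewrite -ler_pdivlMr // ge_min lexx orbT.
have := mulr_gt0 xp pi0; lra.
Qed.

End Flatness.

(** * Integrals of subgaussian functions *)

Section Subgaussian.
Context {R : realType}.
Local Notation mu := (@lebesgue_measure R).
Implicit Types (v w : R -> R).

(** A class of integrands stable under multiplication by polynomials, cos, sin and
    exponentials ([subexp]), so that every integral below converges for the same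
    reason.  The exponent 1/2 is the one met by the eigenfunctions. *)
Definition subgauss w := measurable_fun setT w /\
  exists C b : R, [/\ 0 <= C, 0 <= b & forall x, `|w x| <= C * expR (b * `|x| - x ^+ 2 / 2)].

Definition subexp v := measurable_fun setT v /\
  exists C b : R, [/\ 0 <= C, 0 <= b & forall x, `|v x| <= C * expR (b * `|x|)].

Lemma integrable_expR_quarter : mu.-integrable setT (EFin \o (fun x : R => expR (- (x ^+ 2 / 4)))).
Proof.
have s0 : Num.sqrt 2 != 0 :> R by rewrite gt_eqF // sqrtr_gt0.
have := @integrable_normal_pdf R 0 (Num.sqrt 2).
rewrite normal_pdfE // => /(integrableZl measurableT (normal_peak (Num.sqrt 2))^-1).
apply: eq_integrable => // x _ /=.
rewrite -EFinM; congr EFin; rewrite mulKf ?gt_eqF ?normal_peak_gt0 //.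
by rewrite /normal_fun subr0 sqr_sqrtr // mulNr -mulr_natr -natrM.
Qed.

Lemma integrable_dom v w : mu.-integrable setT (EFin \o w) -> measurable_fun setT v ->
  (forall x, `|v x| <= w x) -> mu.-integrable setT (EFin \o v).
Proof.
move=> iw mv vw; apply: (le_integrable _ _ _ iw) => //; first exact/measurable_EFinP.
by move=> x _ /=; rewrite lee_fin (le_trans (vw x)) // ler_norm.
Qed.

Lemma subgauss_measurable w : subgauss w -> measurable_fun setT w.
Proof. by case. Qed.

Lemma subgauss_integrable w : subgauss w -> mu.-integrable setT (EFin \o w).
Proof.
move=> [mw [C [b [C0 b0 hw]]]].
(* b |x| - x^2/2 <= b^2 - x^2/4, by completing the square. *)
apply: (@integrable_dom w (fun x => C * expR (b ^+ 2) * expR (- (x ^+ 2 / 4)))) => //.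
  have := integrableZl measurableT (C * expR (b ^+ 2)) integrable_expR_quarter.
  by apply: eq_integrable.
move=> x; apply: le_trans (hw x) _; rewrite -mulrA ler_wpM2l // -expRD ler_expR.
rewrite -real_normK ?num_real //; have := sqr_ge0 (b - `|x| / 2); nra.
Qed.

Lemma subgaussM v w : subexp v -> subgauss w -> subgauss (fun x => v x * w x).
Proof.
move=> [mv [C [b [C0 b0 hv]]]] [mw [D [c [D0 c0 hw]]]]; split.
  exact: measurable_funM.
exists (C * D), (b + c); split; rewrite ?mulr_ge0 ?addr_ge0 // => x.
rewrite normrM mulrDl -addrA expRD mulrACA; exact: ler_pM.
Qed.

Lemma subexpM v w : subexp v -> subexp w -> subexp (fun x => v x * w x).
Proof.
move=> [mv [C [b [C0 b0 hv]]]] [mw [D [c [D0 c0 hw]]]]; split.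
  exact: measurable_funM.
exists (C * D), (b + c); split; rewrite ?mulr_ge0 ?addr_ge0 // => x.
rewrite normrM mulrDl expRD mulrACA; exact: ler_pM.
Qed.

Lemma subgaussD v w : subgauss v -> subgauss w -> subgauss (fun x => v x + w x).
Proof.
move=> [mv [C [b [C0 b0 hv]]]] [mw [D [c [D0 c0 hw]]]]; split.
  exact: measurable_funD.
exists (C + D), (b + c); split; rewrite ?addr_ge0 // => x.
apply: le_trans (ler_normD _ _) _; rewrite [leRHS]mulrDl; apply: lerD.
  apply: le_trans (hv x) _; rewrite ler_wpM2l // ler_expR lerD2r ler_wpM2r //; lra.
apply: le_trans (hw x) _; rewrite ler_wpM2l // ler_expR lerD2r ler_wpM2r //; lra.
Qed.

Lemma bounded_subexp v (C : R) : measurable_fun setT v -> (forall x, `|v x| <= C) -> subexp v.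
Proof.
move=> mv hv; split=> //; exists C, 0; split=> //.
  exact: le_trans (normr_ge0 (v 0)) (hv 0).
by move=> x; rewrite mul0r expR0 mulr1.
Qed.

Lemma subexp_cst (C : R) : subexp (fun=> C).
Proof. by apply: (@bounded_subexp _ `|C|). Qed.

Lemma subgaussZ (a : R) w : subgauss w -> subgauss (fun x => a * w x).
Proof. by move=> sw; apply: subgaussM => //; exact: subexp_cst. Qed.

Lemma subgaussB v w : subgauss v -> subgauss w -> subgauss (fun x => v x - w x).
Proof.
move=> sv sw; rewrite (_ : (fun x => _) = fun x => v x + (-1) * w x).
  by apply: subgaussD => //; exact: subgaussZ.
by apply/funext => x; rewrite mulN1r.
Qed.

Lemma subexp_id : subexp (fun x : R => x).
Proof.
split; first exact: measurable_id.
exists 1, 1; split => // x; rewrite !mul1r.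
by apply: le_trans (expR_ge1Dx _); rewrite lerDr.
Qed.

Lemma subexpX v k : subexp v -> subexp (fun x => v x ^+ k).
Proof.
move=> sv; elim: k => [|k IH]; first by under eq_fun do rewrite expr0; exact: subexp_cst.
by under eq_fun do rewrite exprS; exact: subexpM.
Qed.

Lemma subexp_pow k : subexp (fun x : R => x ^+ k).
Proof. exact: subexpX subexp_id. Qed.

Lemma subexp_norm v : subexp v -> subexp (fun x => `|v x|).
Proof.
move=> [mv [C [b [C0 b0 hv]]]]; split; first exact: measurableT_comp.
by exists C, b; split => // x; rewrite normr_id.
Qed.

Lemma subgauss_norm w : subgauss w -> subgauss (fun x => `|w x|).
Proof.
move=> [mw [C [b [C0 b0 hw]]]]; split; first exact: measurableT_comp.
by exists C, b; split => // x; rewrite normr_id.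
Qed.

Lemma subexpD v w : subexp v -> subexp w -> subexp (fun x => v x + w x).
Proof.
move=> [mv [C [b [C0 b0 hv]]]] [mw [D [c [D0 c0 hw]]]]; split.
  exact: measurable_funD.
exists (C + D), (b + c); split; rewrite ?addr_ge0 // => x.
apply: le_trans (ler_normD _ _) _; rewrite [leRHS]mulrDl; apply: lerD.
  apply: le_trans (hv x) _; rewrite ler_wpM2l // ler_expR ler_wpM2r //; lra.
apply: le_trans (hw x) _; rewrite ler_wpM2l // ler_expR ler_wpM2r //; lra.
Qed.

Lemma subexp_horner (p : {poly R}) : subexp (horner p).
Proof.
elim/poly_ind: p => [|p c IH].
  by rewrite (_ : horner 0 = fun=> 0); [exact: subexp_cst|apply/funext => x; rewrite horner0].
rewrite (_ : horner _ = fun x => p.[x] * x + c).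
  by apply: subexpD; [apply: subexpM => //; exact: subexp_id|exact: subexp_cst].
by apply/funext => x; rewrite hornerMXaddC.
Qed.

Lemma subexp_norm_comp (b : R) : 0 <= b -> subexp (fun x => expR (b * `|x|)).
Proof.
move=> b0; split.
  apply: measurableT_comp; first exact: measurable_expR.
  by apply: measurable_funM => //; exact: normr_measurable.
by exists 1, b; split => // x; rewrite mul1r ger0_norm ?expR_ge0.
Qed.

Definition gauss2 (x : R) := expR (- (x ^+ 2 / 2)).

Lemma subgauss_gauss2 : subgauss gauss2.
Proof.
split.
  apply: measurableT_comp; first exact: measurable_expR.
  by apply: measurableT_comp => //; apply: measurable_funM => //; exact: measurable_funX.
by exists 1, 0; split => // x; rewrite mul1r mul0r add0r ger0_norm ?expR_ge0.
Qed.

Lemma subexp_gauss2 : subexp gauss2.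
Proof.
apply: (@bounded_subexp _ 1); first by case: subgauss_gauss2.
by move=> x; rewrite ger0_norm ?expR_ge0 // -expR0 ler_expR oppr_le0 divr_ge0 // sqr_ge0.
Qed.

Lemma subexp_cos (b : R) : subexp (fun x => cos (b * x)).
Proof.
apply: (@bounded_subexp _ 1) => [|x]; last exact: norm_cos_le1.
apply: continuous_measurable_fun => x; apply: continuous_comp; last exact: continuous_cos.
by apply: cvgMr; exact: cvg_id.
Qed.

Lemma subexp_sin (b : R) : subexp (fun x => sin (b * x)).
Proof.
apply: (@bounded_subexp _ 1) => [|x]; last exact: norm_sin_le1.
apply: continuous_measurable_fun => x; apply: continuous_comp; last exact: continuous_sin.
by apply: cvgMr; exact: cvg_id.
Qed.

Lemma subexp_expR (b : R) : subexp (fun x => expR (b * x)).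
Proof.
split.
  by apply: measurableT_comp; [exact: measurable_expR|exact: measurable_funM].
exists 1, `|b|; split => // x; rewrite mul1r ger0_norm ?expR_ge0 // ler_expR.
by rewrite -normrM ler_norm.
Qed.

Definition Int w := \int[mu]_x w x.

Lemma eq_Int v w : v =1 w -> Int v = Int w.
Proof. by move=> /funext ->. Qed.

Lemma IntD v w : subgauss v -> subgauss w -> Int (fun x => v x + w x) = Int v + Int w.
Proof. by move=> sv sw; rewrite /Int RintegralD //; exact: subgauss_integrable. Qed.

Lemma IntB v w : subgauss v -> subgauss w -> Int (fun x => v x - w x) = Int v - Int w.
Proof. by move=> sv sw; rewrite /Int RintegralB //; exact: subgauss_integrable. Qed.

Lemma IntZ (a : R) w : subgauss w -> Int (fun x => a * w x) = a * Int w.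
Proof. by move=> sw; rewrite /Int RintegralZl //; exact: subgauss_integrable. Qed.

Lemma Int0 : Int (fun=> 0) = 0.
Proof. by have := IntZ 0 subgauss_gauss2; under eq_Int do rewrite mul0r; rewrite mul0r. Qed.

Lemma subgauss_sum (u : nat -> R -> R) n : (forall j, subgauss (u j)) ->
  subgauss (fun x => \sum_(j < n) u j x).
Proof.
move=> su; elim: n => [|n IH].
  under eq_fun do rewrite big_ord0; have := subgaussZ 0 subgauss_gauss2.
  by under eq_fun do rewrite mul0r.
by under eq_fun do rewrite big_ord_recr /=; exact: subgaussD.
Qed.

Lemma Int_sum (u : nat -> R -> R) n : (forall j, subgauss (u j)) ->
  Int (fun x => \sum_(j < n) u j x) = \sum_(j < n) Int (u j).
Proof.
move=> su; elim: n => [|n IH].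
  by under eq_Int do rewrite big_ord0; rewrite big_ord0 Int0.
under eq_Int do rewrite big_ord_recr /=.
by rewrite IntD ?IH ?big_ord_recr //; exact: subgauss_sum.
Qed.

Lemma norm_Int_le v w : subgauss v -> subgauss w -> (forall x, `|v x| <= w x) ->
  `|Int v| <= Int w.
Proof.
move=> sv sw vw; have iv := subgauss_integrable sv; have iw := subgauss_integrable sw.
apply: le_trans (le_normr_Rintegral _ iv) _ => //.
by apply: le_Rintegral => //; exact: integrable_norm.
Qed.

Lemma Int_dominated (u : nat -> R -> R) (g w : R -> R) : (forall n, subgauss (u n)) ->
  measurable_fun setT g -> subgauss w -> (forall n x, `|u n x| <= w x) ->
  (forall x, u n x @[n --> \oo] --> g x) -> Int (u n) @[n --> \oo] --> Int g.
Proof.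
move=> su mg sw uw ug.
have [] := @dominated_convergence _ _ R mu setT measurableT
  (fun n => EFin \o u n) (EFin \o g) (EFin \o w).
- by move=> n; apply/measurable_EFinP; case: (su n).
- exact/measurable_EFinP.
- by apply: aeW => x _; apply: cvg_EFin; [exact: nearW|exact: ug].
- exact: subgauss_integrable.
- by apply: aeW => x n _ /=; rewrite lee_fin.
move=> ig _ h.
rewrite /Int /Rintegral; apply: fine_cvg; rewrite fineK //.
exact: integrable_fin_num.
Qed.

Lemma Int_series (u : nat -> R -> R) (g w : R -> R) : (forall n, subgauss (u n)) ->
  measurable_fun setT g -> subgauss w -> (forall n x, `|\sum_(j < n) u j x| <= w x) ->
  (forall x, \sum_(j < n) u j x @[n --> \oo] --> g x) ->
  \sum_(j < n) Int (u j) @[n --> \oo] --> Int g.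
Proof.
move=> su mg sw uw ug; under eq_fun do rewrite -Int_sum //.
by apply: Int_dominated sw uw ug => // n; exact: subgauss_sum.
Qed.

End Subgaussian.

(** * Series expansions under the integral *)

Section GaussianFourier.
Context {R : realType}.
Local Notation mu := (@lebesgue_measure R).
Implicit Types (v w : R -> R) (a : bool).

Lemma subgauss_cvg0 w : subgauss w ->
  w n%:R @[n --> \oo] --> (0 : R) /\ w (- n%:R) @[n --> \oo] --> (0 : R).
Proof.
move=> [_ [C [b [C0 b0 hw]]]].
(* b x - x^2/2 <= (b + 1)^2/2 - x, by completing the square. *)
pose u n : R := C * expR ((b + 1) ^+ 2 / 2) * expR (- 1) ^+ n.
have u0 : u @ \oo --> (0 : R).
  rewrite -[X in _ --> X](mulr0 (C * expR ((b + 1) ^+ 2 / 2))).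
  apply: cvgMr; apply: cvg_expr.
  by rewrite ger0_norm ?expR_ge0 // -expR0 ltr_expR; lra.
have hu x n : `|x| = n%:R -> `|w x| <= u n.
  move=> xn; apply: le_trans (hw x) _; rewrite /u -mulrA ler_wpM2l // -expRM_natl -expRD.
  rewrite ler_expR -[x ^+ 2]real_normK ?num_real // xn.
  by have := sqr_ge0 (n%:R - (b + 1)); nra.
split; apply/norm_cvg0P; apply: (@squeeze_cvgr _ _ _ _ (cst 0) u) => //; try exact: cvg_cst.
- by apply: nearW => n; rewrite normr_ge0 /= hu // ger0_norm.
- by apply: nearW => n; rewrite normr_ge0 /= hu // normrN ger0_norm.
Qed.

(** The fundamental theorem of calculus on [-n, n] and dominated convergence. *)
Lemma Int_derivative (F G : R -> R) : (forall x : R, is_derive x 1 F (G x)) ->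
  continuous G -> subgauss F -> subgauss G -> Int G = 0.
Proof.
move=> dF cG sF sG.
have [F1 F2] := subgauss_cvg0 sF.
have mI n : measurable (`[- n.+1%:R, n.+1%:R]%classic : set R) by exact: measurable_itv.
pose u n := G \_ `[- n.+1%:R, n.+1%:R].
have nu n x : `|u n x| <= `|G x|.
  by rewrite /u /restrict; case: ifPn => // _; rewrite normr0.
have su n : subgauss (u n).
  split; first by apply/(measurable_restrictT _ (mI n)); apply: measurable_funTS; case: sG.
  have [_ [C [b [C0 b0 h]]]] := sG; exists C, b; split => // x.
  exact: le_trans (nu n x) (h x).
have lim1 : Int (u n) @[n --> \oo] --> Int G.
  apply: (@Int_dominated _ u G (fun x => `|G x|)) => //.
  - by case: sG.
  - exact: subgauss_norm.
  - move=> x; apply: cvg_near_cst; near=> n.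
    rewrite /u patchE ifT // inE /= in_itv /= -ler_norml.
    have : `|x| <= n%:R by near: n; exact: nbhs_infty_ger.
    by move=> h; apply: le_trans h _; rewrite ler_nat.
have val n : Int (u n) = F n.+1%:R - F (- n.+1%:R).
  rewrite /Int -Rintegral_mkcond /Rintegral.
  rewrite (@continuous_FTC2 _ G F) //.
  - by rewrite gtrN.
  - exact: continuous_subspaceT.
  - have cF (x : R) : {for x, continuous F}.
      by apply: differentiable_continuous; apply/derivable1_diffP; case: (dF x).
    split; first by move=> x _; case: (dF x).
    + exact/cvg_at_right_filter/cF.
    + exact/cvg_at_left_filter/cF.
  - by move=> x _; rewrite derive1E; case: (dF x).
have lim2 : Int (u n) @[n --> \oo] --> (0 : R).
  have h1 : F n.+1%:R @[n --> \oo] --> (0 : R) by rewrite (cvg_shiftS (fun n => F n%:R)).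
  have h2 : F (- n.+1%:R) @[n --> \oo] --> (0 : R).
    by rewrite (cvg_shiftS (fun n => F (- n%:R))).
  have E : (fun n => Int (u n)) = (fun n => F n.+1%:R - F (- n.+1%:R)) :> (nat -> R).
    by apply/funext => n; exact: val.
  by rewrite E -(subrr 0); exact: cvgB h1 h2.
exact: cvg_unique lim1 lim2.
Unshelve. all: by end_near. Qed.

Lemma is_derive_gauss2 (x : R) : is_derive x 1 (@gauss2 R) (- x * gauss2 x).
Proof.
have h2 : is_derive x 1 (fun y : R => y ^+ 2) (2 * x).
  by apply: is_derive_eq; rewrite /GRing.scale /=; ring.
have h : is_derive x 1 (fun y : R => - (y ^+ 2 / 2)) (- x).
  have := is_derive_scale (- 2^-1) h2.
  rewrite (_ : (fun y => - 2^-1 * y ^+ 2) = fun y => - (y ^+ 2 / 2)).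
    by rewrite (_ : - 2^-1 * (2 * x) = - x) //; field.
  by apply/funext => y; rewrite mulNr mulrC.
have := @is_derive1_comp _ expR (fun y => - (y ^+ 2 / 2)) x _ _ (is_derive_expR _) h.
by rewrite mulrC.
Qed.

Lemma continuous_gauss2 : continuous (@gauss2 R).
Proof.
move=> x; apply: differentiable_continuous; apply/derivable1_diffP.
by case: (is_derive_gauss2 x).
Qed.

(** The flag [a] is the parity of the eigenfunction: [trig true] and [hyp true] are
    the odd functions sin and sinh. *)
Definition trig a (x : R) := if a then sin x else cos x.
Definition hyp a (x : R) := (expR x + (-1) ^+ a * expR (- x)) / 2.

Lemma norm_trig_le1 a x : `|trig a x| <= 1.
Proof. by case: a; [exact: norm_sin_le1|exact: norm_cos_le1]. Qed.

Lemma subexp_trig a (b : R) : subexp (fun x => trig a (b * x)).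
Proof. by case: a; [exact: subexp_sin|exact: subexp_cos]. Qed.

Lemma subexp_hyp a (b : R) : subexp (fun x => hyp a (b * x)).
Proof.
have h := subexpM (subexp_cst 2^-1) (subexpD (subexp_expR b)
  (subexpM (subexp_cst ((-1) ^+ a)) (subexp_expR (- b)))).
rewrite (_ : (fun x => _) =
  fun x => 2^-1 * (expR (b * x) + (-1) ^+ a * expR (- b * x))) //.
by apply/funext => x; rewrite /hyp mulrC mulNr.
Qed.

Lemma hyp_partial a (y : R) n :
  \sum_(j < n) y ^+ (j.*2 + a) / (j.*2 + a)`!%:R =
  (\sum_(k < n.*2) y ^+ k / k`!%:R + (-1) ^+ a * \sum_(k < n.*2) (- y) ^+ k / k`!%:R) / 2.
Proof.
elim: n => [|n IH]; first by rewrite !big_ord0 mulr0 addr0 mul0r.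
rewrite big_ord_recr /= IH doubleS !big_ord_recr /=.
have e2 : (-1) ^+ n.*2 = 1 :> R by rewrite -mul2n exprM sqrrN !expr1n.
rewrite !(exprNn y) [(-1) ^+ n.*2.+1]exprS e2.
by case: a {IH}; rewrite ?addn1 ?addn0 ?expr0 ?expr1; field; rewrite !pnatr_eq0 -!lt0n !fact_gt0.
Qed.

Lemma cvg_hyp a (y : R) :
  \sum_(j < n) y ^+ (j.*2 + a) / (j.*2 + a)`!%:R @[n --> \oo] --> hyp a y.
Proof.
have e (z : R) : \sum_(k < n.*2) z ^+ k / k`!%:R @[n --> \oo] --> expR z.
  have h := @is_cvg_series_exp_coeff R z.
  have d : (fun n => n.*2) @ \oo --> \oo.
    by apply/cvgnyPge => A; near=> n; rewrite -addnn; apply: leq_trans (leq_addl _ _); near: n; exact: nbhs_infty_ge.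
  have := cvg_comp _ _ d h; rewrite -/(expR z).
  by under [X in X @ _ --> _ -> _]eq_fun do rewrite /= /series /= big_mkord.
under eq_fun do rewrite hyp_partial.
by apply: cvgMl; apply: cvgD; [exact: e|apply: cvgMr; exact: e].
Unshelve. all: by end_near. Qed.

Lemma hyp_le_expR a (y : R) : 0 <= y -> hyp a y <= expR y.
Proof.
move=> y0; rewrite /hyp ler_pdivrMr // mulr_natr mulr2n lerD2l.
apply: le_trans (ler_norm _) _; rewrite normrM normrX normrN1 expr1n mul1r.
by rewrite ger0_norm ?expR_ge0 // ler_expR; lra.
Qed.

Lemma hyp_partial_le a (y : R) n (s : nat -> R) : (forall j, `|s j| <= 1) ->
  `|\sum_(j < n) s j * (y ^+ (j.*2 + a) / (j.*2 + a)`!%:R)| <= expR `|y|.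
Proof.
move=> s1; apply: le_trans (ler_norm_sum _ _ _) _.
apply: (@le_trans _ _ (\sum_(j < n) `|y| ^+ (j.*2 + a) / (j.*2 + a)`!%:R)).
  apply: ler_sum => j _; rewrite normrM [X in _ * X <= _]normrM normrX.
  by rewrite [`|_^-1|]ger0_norm ?invr_ge0 // ler_piMl // divr_ge0 // exprn_ge0.
apply: le_trans (hyp_le_expR a (normr_ge0 y)).
have h := @cvg_hyp a `|y|.
rewrite -(cvg_lim _ h) //; apply: (nondecreasing_cvgn_le (u_ := fun n => _)).
  apply/nondecreasing_seqP => k; rewrite big_ord_recr /= lerDl.
  by rewrite divr_ge0 // exprn_ge0.
by apply/cvg_ex; exists (hyp a `|y|).
Qed.

Lemma cvg_trig a (y : R) :
  \sum_(j < n) (-1) ^+ j * (y ^+ (j.*2 + a) / (j.*2 + a)`!%:R) @[n --> \oo] --> trig a y.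
Proof.
case: a.
  have := @cvg_sin_coeff' R y.
  rewrite /series /= => h; rewrite (_ : (fun n => _) = fun n => \sum_(0 <= k < n) sin_coeff' y k) //.
  by apply/funext => n; rewrite big_mkord; apply: eq_bigr => i _; rewrite /sin_coeff' addn1 mulrA.
have := @cvg_cos_coeff' R y.
rewrite /series /= => h; rewrite (_ : (fun n => _) = fun n => \sum_(0 <= k < n) cos_coeff' y k) //.
by apply/funext => n; rewrite big_mkord; apply: eq_bigr => i _; rewrite /cos_coeff' addn0 mulrA.
Qed.

(** Termwise integration; all partial sums of the series are dominated by
    e^(|b| |x|) ([hyp_partial_le]). *)
Lemma Int_power_series a (b : R) (s : nat -> R) (g : R -> R) w : subgauss w ->
  (forall j, `|s j| <= 1) -> measurable_fun setT g ->
  (forall x : R, \sum_(j < n) s j * ((b * x) ^+ (j.*2 + a) / (j.*2 + a)`!%:R) @[n --> \oo] --> g x) ->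
  \sum_(j < n) s j * b ^+ (j.*2 + a) / (j.*2 + a)`!%:R * Int (fun x => x ^+ (j.*2 + a) * w x)
    @[n --> \oo] --> Int (fun x => g x * w x).
Proof.
move=> sw s1 mg hg.
pose u j x := s j * b ^+ (j.*2 + a) / (j.*2 + a)`!%:R * (x ^+ (j.*2 + a) * w x).
have sx j : subgauss (fun x : R => x ^+ (j.*2 + a) * w x).
  by apply: subgaussM => //; exact: subexp_pow.
under eq_fun do under eq_bigr do rewrite -IntZ //.
have uE n x : \sum_(j < n) u j x =
    (\sum_(j < n) s j * ((b * x) ^+ (j.*2 + a) / (j.*2 + a)`!%:R)) * w x.
  by rewrite mulr_suml; apply: eq_bigr => j _; rewrite /u exprMn; ring.
apply: (@Int_series _ u _ (fun x => expR (`|b| * `|x|) * `|w x|)).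
- by move=> j; exact: subgaussZ.
- by apply: measurable_funM => //; case: sw.
- by apply: subgaussM; [exact: subexp_norm_comp|exact: subgauss_norm].
- move=> n x; rewrite uE normrM -[`|b| * `|x|]normrM ler_wpM2r //; exact: hyp_partial_le.
- by move=> x; under eq_fun do rewrite uE; apply: cvgMl; exact: hg.
Qed.

Lemma Int_trig_series a (b : R) w : subgauss w ->
  \sum_(j < n) (-1) ^+ j * b ^+ (j.*2 + a) / (j.*2 + a)`!%:R * Int (fun x => x ^+ (j.*2 + a) * w x)
    @[n --> \oo] --> Int (fun x => trig a (b * x) * w x).
Proof.
move=> sw; apply: Int_power_series => //.
- by move=> j; rewrite normrX normrN1 expr1n.
- by case: (subexp_trig a b).
- by move=> x; exact: cvg_trig.
Qed.

Lemma Int_hyp_series a (b : R) w : subgauss w ->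
  \sum_(j < n) b ^+ (j.*2 + a) / (j.*2 + a)`!%:R * Int (fun x => x ^+ (j.*2 + a) * w x)
    @[n --> \oo] --> Int (fun x => hyp a (b * x) * w x).
Proof.
move=> sw.
under eq_fun do under eq_bigr do rewrite -[b ^+ _]mul1r.
apply: (@Int_power_series a b (fun=> 1)) => //.
- by move=> j; rewrite normr1.
- by case: (subexp_hyp a b).
- by move=> x; under eq_fun do under eq_bigr do rewrite mul1r; exact: cvg_hyp.
Qed.

End GaussianFourier.

(** * Fourier transforms of Gaussians *)

Section GaussianTransforms.
Context {R : realType}.
Implicit Types (v w : R -> R) (a : bool).

Lemma Int_gauss2 : Int (@gauss2 R) = Num.sqrt (2 * pi).
Proof.
have one0 : 1 != 0 :> R by rewrite oner_neq0.
have := @integral_normal_pdf R 0 1; rewrite normal_pdfE // => h.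
have : Int (fun x : R => (Num.sqrt (2 * pi))^-1 * gauss2 x) = 1.
  rewrite /Int /Rintegral -[RHS]/(fine 1%E) -h; congr fine; apply: eq_integral => x _.
  congr EFin; rewrite /normal_peak /normal_fun /gauss2 subr0 expr1n mul1r.
  by rewrite mulr_natl mulNr.
rewrite IntZ; last exact: subgauss_gauss2.
by move/(canRL (mulKf _)) => ->; rewrite ?invrK ?mulr1 // invr_neq0 // gt_eqF // sqrtr_gt0 mulr_gt0 // pi_gt0.
Qed.

(** -x is the logarithmic derivative of [gauss2]. *)
Lemma Int_by_parts v dv : (forall x : R, is_derive x 1 v (dv x)) -> continuous dv ->
  subexp v -> subexp dv ->
  Int (fun x => x * v x * gauss2 x) = Int (fun x => dv x * gauss2 x).
Proof.
move=> hv cdv sv sdv; have sg := @subgauss_gauss2 R.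
have s1 : subgauss (fun x => dv x * gauss2 x) by exact: subgaussM.
have s2 : subgauss (fun x => x * v x * gauss2 x).
  by apply: subgaussM => //; apply: subexpM => //; exact: subexp_id.
apply/eqP; rewrite eq_sym -subr_eq0 -IntB //; apply/eqP.
apply: (@Int_derivative _ (fun x => v x * gauss2 x)).
- move=> x; have h1 := hv x; have h2 := @is_derive_gauss2 R x.
  apply: (is_derive_eq (is_deriveM h1 h2)).
  by rewrite /GRing.scale /=; ring.
- have cv : continuous v.
    by move=> x; apply: differentiable_continuous; apply/derivable1_diffP; case: (hv x).
  move=> x; apply: cvgB; apply: cvgM.
  + exact: cdv.
  + exact: continuous_gauss2.
  + by apply: cvgM; [exact: cvg_id|exact: cv].
  + exact: continuous_gauss2.
- exact: subgaussM.
- exact: subgaussB.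
Qed.

Lemma is_derive_pow k (x : R) : is_derive x 1 (fun y => y ^+ k) (k%:R * x ^+ k.-1).
Proof.
have h : is_derive x 1 (id ^+ k : R -> R) (k%:R * x ^+ k.-1).
  by apply: is_derive_eq; rewrite /GRing.scale /= mulr1.
by rewrite exprfctE in h.
Qed.

Lemma continuous_pow k : continuous (fun y : R => y ^+ k).
Proof. exact: exprn_continuous. Qed.

Lemma Int_pow_gauss2 k :
  Int (fun x : R => x ^+ k.+2 * gauss2 x) = k.+1%:R * Int (fun x : R => x ^+ k * gauss2 x).
Proof.
rewrite -IntZ; last by apply: subgaussM; [exact: subexp_pow|exact: subgauss_gauss2].
have h : Int (fun x : R => x * x ^+ k.+1 * gauss2 x) =
    Int (fun x => k.+1%:R * x ^+ k * gauss2 x).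
  apply: (@Int_by_parts (fun x => x ^+ k.+1) (fun x => k.+1%:R * x ^+ k)).
  - by move=> x; exact: is_derive_pow.
  - by move=> x; apply: cvgMr; exact: continuous_pow.
  - exact: subexp_pow.
  - by apply: subexpM; [exact: subexp_cst|exact: subexp_pow].
transitivity (Int (fun x : R => x * x ^+ k.+1 * gauss2 x)).
  by apply: eq_Int => x; rewrite -exprS.
by rewrite h; apply: eq_Int => x; rewrite mulrA.
Qed.

Lemma Int_odd_gauss2 j : Int (fun x : R => x ^+ j.*2.+1 * gauss2 x) = 0.
Proof.
elim: j => [|j IH]; last by rewrite doubleS Int_pow_gauss2 IH mulr0.
have h : Int (fun x : R => x * 1 * gauss2 x) = Int (fun x => 0 * gauss2 x).
  apply: (@Int_by_parts (fun=> 1) (fun=> 0)).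
  - by move=> x; exact: cvg_cst.
  - exact: subexp_cst.
  - exact: subexp_cst.
transitivity (Int (fun x : R => x * 1 * gauss2 x)).
  by apply: eq_Int => x; rewrite expr1 mulr1.
by rewrite h; under eq_Int do rewrite mul0r; exact: Int0.
Qed.

Lemma Int_even_gauss2 j : Int (fun x : R => x ^+ j.*2 * gauss2 x) =
  Num.sqrt (2 * pi) * (j.*2`!%:R / (2 ^+ j * j`!%:R)).
Proof.
elim: j => [|j IH].
  by under eq_Int do rewrite mul1r; rewrite Int_gauss2 double0 fact0 expr0 mulr1 divr1 mulr1.
rewrite doubleS Int_pow_gauss2 IH !factS !natrM exprS.
have -> : j.*2.+2%:R = 2 * j.+1%:R :> R by rewrite -natrM mul2n doubleS.
by field; rewrite nat1r !pnatr_eq0 -!lt0n fact_gt0 expf_neq0.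
Qed.

(** Integrating the cosine series termwise, the even Gaussian moments turn it into
    the exponential series of -y^2/2. *)
Lemma Int_cos_gauss2 (y : R) :
  Int (fun x => cos (y * x) * gauss2 x) = Num.sqrt (2 * pi) * gauss2 y.
Proof.
have h := @Int_trig_series R false y _ subgauss_gauss2.
have h2 : \sum_(j < n) (-1) ^+ j * y ^+ (j.*2 + false) / (j.*2 + false)`!%:R *
    Int (fun x : R => x ^+ (j.*2 + false) * gauss2 x) @[n --> \oo] -->
    Num.sqrt (2 * pi) * gauss2 y.
  set t := (X in X @ _ --> _).
  have -> : t = (fun n => Num.sqrt (2 * pi) * series (exp_coeff (- (y ^+ 2 / 2))) n) :> (nat -> R).
    apply/funext => n; rewrite /t /series /= big_mkord mulr_sumr; apply: eq_bigr => j _.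
    have e : (- (y ^+ 2 / 2)) ^+ j = (-1) ^+ j * (y ^+ j.*2 / 2 ^+ j).
      by rewrite -mul2n exprM -expr_div_n -exprMn mulN1r.
    rewrite addn0 Int_even_gauss2 /exp_coeff /= e.
    by field; rewrite !pnatr_eq0 -!lt0n !fact_gt0 expf_neq0.
  by apply: cvgMr; exact: is_cvg_series_exp_coeff.
exact: cvg_unique h h2.
Qed.

Lemma Int_sin_gauss2 (y : R) : Int (fun x => sin (y * x) * gauss2 x) = 0.
Proof.
have h := @Int_trig_series R true y _ subgauss_gauss2.
have h2 : \sum_(j < n) (-1) ^+ j * y ^+ (j.*2 + true) / (j.*2 + true)`!%:R *
    Int (fun x : R => x ^+ (j.*2 + true) * gauss2 x) @[n --> \oo] --> (0 : R).
  set t := (X in X @ _ --> _).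
  have -> : t = (fun=> 0) :> (nat -> R); last exact: cvg_cst.
  by apply/funext => n; rewrite /t big1 // => j _; rewrite addn1 Int_odd_gauss2 mulr0.
exact: cvg_unique h h2.
Qed.

Lemma is_derive_cos_mul (k th : R) :
  is_derive th 1 (fun t => cos (k * t)) (- k * sin (k * th)).
Proof.
have -> : (fun t => cos (k * t)) = cos \o (k \*: id) by [].
by apply: is_derive_eq; rewrite /= /GRing.scale /= mulr1; ring.
Qed.

Lemma is_derive_trig a (y x : R) : is_derive x 1 (fun t => trig a (y * t))
  ((if a then y else - y) * trig (~~ a) (y * x)).
Proof. by case: a; [exact: is_derive_sin_mul|exact: is_derive_cos_mul]. Qed.

Lemma continuous_trig a (y : R) : continuous (fun t => trig a (y * t)).
Proof.
by move=> x; apply: differentiable_continuous; apply/derivable1_diffP; case: (is_derive_trig a y x).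
Qed.

(** Integration by parts expresses the transform of x^(j+1) e^(-x^2/2) by those of
    x^(j-1) e^(-x^2/2) and x^j e^(-x^2/2), the latter with cos and sin exchanged;
    hence an induction on two consecutive powers and both parities at once. *)
Lemma Int_pow_trig_gauss2 l a : exists p : {poly R}, forall y : R,
  Int (fun x => x ^+ l * trig a (y * x) * gauss2 x) = p.[y] * gauss2 y.
Proof.
have sg := @subgauss_gauss2 R.
have st k b (y : R) : subexp (fun x => x ^+ k * trig b (y * x)).
  by apply: subexpM; [exact: subexp_pow|exact: subexp_trig].
suff P k : (forall b, exists p : {poly R}, forall y : R,
    Int (fun x => x ^+ k * trig b (y * x) * gauss2 x) = p.[y] * gauss2 y) /\
    (forall b, exists p : {poly R}, forall y : R,
    Int (fun x => x ^+ k.+1 * trig b (y * x) * gauss2 x) = p.[y] * gauss2 y).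
  by have [+ _] := P l; apply.
have step j b (y : R) : Int (fun x => x ^+ j.+1 * trig b (y * x) * gauss2 x) =
    j%:R * Int (fun x => x ^+ j.-1 * trig b (y * x) * gauss2 x) +
    (if b then y else - y) * Int (fun x => x ^+ j * trig (~~ b) (y * x) * gauss2 x).
  rewrite -!IntZ; try exact: subgaussM.
  rewrite -IntD; try by apply: subgaussZ; exact: subgaussM.
  pose dv (x : R) : R := j%:R * x ^+ j.-1 * trig b (y * x) +
    x ^+ j * ((if b then y else - y) * trig (~~ b) (y * x)).
  have h : Int (fun x : R => x * (x ^+ j * trig b (y * x)) * gauss2 x) =
      Int (fun x => dv x * gauss2 x).
    apply: (@Int_by_parts (fun x => x ^+ j * trig b (y * x)) dv).
    - move=> x; have h1 := is_derive_pow j x; have h2 := is_derive_trig b y x.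
      apply: (is_derive_eq (is_deriveM h1 h2)).
      by rewrite /GRing.scale /= /dv; ring.
    - move=> x; apply: cvgD; apply: cvgM.
      + by apply: cvgMr; exact: continuous_pow.
      + exact: continuous_trig.
      + exact: continuous_pow.
      + by apply: cvgMr; exact: continuous_trig.
    - exact: st.
    - apply: subexpD.
        by apply: subexpM; [apply: subexpM; [exact: subexp_cst|exact: subexp_pow]|exact: subexp_trig].
      by apply: subexpM; [exact: subexp_pow|apply: subexpM; [exact: subexp_cst|exact: subexp_trig]].
  transitivity (Int (fun x => x * (x ^+ j * trig b (y * x)) * gauss2 x)).
    by apply: eq_Int => x; rewrite exprS -[x * _ * trig _ _]mulrA.
  by rewrite h; apply: eq_Int => x; rewrite /dv; ring.
have base b : exists p : {poly R}, forall y : R,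
    Int (fun x => x ^+ 0 * trig b (y * x) * gauss2 x) = p.[y] * gauss2 y.
  case: b.
    exists 0 => y; under eq_Int do rewrite expr0 mul1r.
    by rewrite Int_sin_gauss2 horner0 mul0r.
  exists (Num.sqrt (2 * pi))%:P => y; under eq_Int do rewrite expr0 mul1r.
  by rewrite Int_cos_gauss2 hornerC.
have next j : (forall b, exists p : {poly R}, forall y : R,
      Int (fun x => x ^+ j.-1 * trig b (y * x) * gauss2 x) = p.[y] * gauss2 y) ->
    (forall b, exists p : {poly R}, forall y : R,
      Int (fun x => x ^+ j * trig b (y * x) * gauss2 x) = p.[y] * gauss2 y) ->
    forall b, exists p : {poly R}, forall y : R,
      Int (fun x => x ^+ j.+1 * trig b (y * x) * gauss2 x) = p.[y] * gauss2 y.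
  move=> h0 h1 b; have [p hp] := h0 b; have [q hq] := h1 (~~ b).
  exists (j%:R *: p + (if b then 'X else - 'X) * q) => y; rewrite step hp hq.
  rewrite hornerD hornerZ hornerM; case: b {hp hq}; rewrite ?hornerN hornerX; ring.
elim: k => [|k [IH1 IH2]]; split => //; first exact: next.
exact: (next k.+1).
Qed.

Lemma gauss2D (y b : R) : gauss2 (y + b) = gauss2 y * gauss2 b * expR (- (b * y)).
Proof. by rewrite /gauss2 -!expRD; congr expR; field. Qed.

(** The product formula reduces this to [Int_cos_gauss2] at y - b and y + b. *)
Lemma Int_trig_trig_gauss2 a (y b : R) :
  Int (fun x => trig a (y * x) * (trig a (b * x) * gauss2 x)) =
  Num.sqrt (2 * pi) * (gauss2 y * gauss2 b * hyp a (b * y)).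
Proof.
have sc k : subgauss (fun x : R => cos (k * x) * gauss2 x).
  by apply: subgaussM; [exact: subexp_cos|exact: subgauss_gauss2].
transitivity (Int (fun x => 2^-1 * (cos ((y - b) * x) * gauss2 x) +
    2^-1 * (-1) ^+ a * (cos ((y + b) * x) * gauss2 x))).
  apply: eq_Int => x; rewrite [(y + b) * x]mulrDl [(y - b) * x]mulrBl cosB cosD /trig.
  by case: a; rewrite ?expr1 ?expr0; field.
rewrite IntD; try exact: subgaussZ.
rewrite !IntZ // !Int_cos_gauss2 !gauss2D.
have -> : gauss2 (- b) = gauss2 b by rewrite /gauss2 sqrrN.
by rewrite mulNr opprK /hyp; field.
Qed.

End GaussianTransforms.

(** * Exponential generating functions *)

Section ExponentialGeneratingFunctions.
Context {R : realType}.
Implicit Types (e : nat -> R) (t : R).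

Definition geometric_growth e := exists C B : R, [/\ 0 <= C, 0 <= B & forall j, `|e j| <= C * B ^+ j].

Definition egf e t := limn (pseries (fun j => e j / j`!%:R) t).

Lemma geometric_growth_shift e : geometric_growth e -> geometric_growth (fun j => e j.+1).
Proof.
move=> [C [B [C0 B0 h]]]; exists (C * B), B; split; rewrite ?mulr_ge0 // => j.
by apply: le_trans (h _) _; rewrite exprS mulrA.
Qed.

Lemma geometric_growth_fdiff e : geometric_growth e -> geometric_growth (fdiff e).
Proof.
move=> [C [B [C0 B0 h]]]; exists (C * B + C), B; split; rewrite ?addr_ge0 ?mulr_ge0 // => j.
apply: le_trans (ler_normB _ _) _; rewrite mulrDl; apply: lerD => //.
by apply: le_trans (h _) _; rewrite exprS mulrA.
Qed.

Lemma poly_growth_geometric_growth M (C : R) e : 0 <= C -> poly_growth M C e -> geometric_growth e.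
Proof.
move=> C0 be; exists C, (2 ^+ M); split => // j; apply: le_trans (be j) _; rewrite ler_wpM2l // -exprM mulnC exprM.
by rewrite lerXn2r ?nnegrE ?exprn_ge0 // -natrX ler_nat ltn_expl.
Qed.

Lemma cvg_egf e t : geometric_growth e -> cvgn (pseries (fun j => e j / j`!%:R) t).
Proof.
move=> [C [B [C0 B0 h]]].
apply: normed_cvg; rewrite /normed_series_of /=.
apply: (@series_le_cvg _ _ (fun j => C * exp_coeff (B * `|t|) j)).
- by [].
- by move=> n; rewrite mulr_ge0 // exp_coeff_ge0 // mulr_ge0.
- move=> j; rewrite !normrM normrX [`|_^-1|]ger0_norm ?invr_ge0 // /exp_coeff /= exprMn.
  by rewrite -!mulrA [_^-1 * _]mulrC !mulrA ler_wpM2r ?invr_ge0 // ler_wpM2r ?exprn_ge0.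
- exact: (@is_cvg_seriesZ _ _ C (is_cvg_series_exp_coeff (B * `|t|))).
Qed.

Lemma egf0 e : egf e 0 = e 0%N.
Proof.
rewrite /egf; apply: cvg_lim => //.
rewrite -cvg_shiftS; set u := (X in X @ _ --> _).
have -> : u = (fun=> e 0%N) :> (nat -> R); last exact: cvg_cst.
apply/funext => n; rewrite /u /pseries /series /= big_nat_recl // expr0 fact0 divr1 mulr1.
by rewrite big1 ?addr0 // => i _; rewrite expr0n /= mulr0.
Qed.

Lemma is_derive_egf e t : geometric_growth e -> is_derive t 1 (egf e) (egf (fun j => e j.+1) t).
Proof.
move=> ge.
have dE (a : nat -> R) : pseries_diffs (fun j => a j / j`!%:R) = fun j => a j.+1 / j`!%:R.
  apply/funext => j; rewrite /pseries_diffs factS natrM.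
  by field; rewrite nat1r !pnatr_eq0 -lt0n fact_gt0.
have g1 := geometric_growth_shift ge; have g2 := geometric_growth_shift g1.
have := @pseries_snd_diffs R (fun j => e j / j`!%:R) (`|t| + 1) t.
rewrite !dE; apply; try exact: cvg_egf.
by rewrite [ltRHS]ger0_norm ?addr_ge0 // ltrDl.
Qed.

(** Differentiating an exponential generating function shifts the sequence. *)
Lemma egf_fdiff e t : geometric_growth e -> egf (fdiff e) t = egf (fun j => e j.+1) t - egf e t.
Proof.
move=> ge; have g1 := geometric_growth_shift ge.
rewrite {1}/egf; apply: cvg_lim => //.
set u := (X in X @ _ --> _).
have -> : u = (fun n => pseries (fun j => e j.+1 / j`!%:R) t n
                - pseries (fun j => e j / j`!%:R) t n) :> (nat -> R).
  apply/funext => n; rewrite /u /pseries /series /= -sumrB; apply: eq_bigr => j _.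
  by rewrite /fdiff; ring.
by apply: cvgB; exact: cvg_egf.
Qed.

(** The Poisson transform of [e], e^(-t) sum_j e_j t^j / j!.  Its derivative is the
    [pgf] of the differences of [e], so its Taylor coefficients at 0 are the
    iterated differences of [e] at 0. *)
Definition pgf e t := expR (- t) * egf e t.

Lemma is_derive_expRN t : is_derive t 1 (fun x : R => expR (- x)) (- expR (- t)).
Proof.
have h : is_derive t 1 (fun x : R => - x) (- 1) by exact: is_deriveN.
have := @is_derive1_comp _ expR (fun y => - y) t _ _ (is_derive_expR _) h.
by rewrite mulrN1.
Qed.

Lemma is_derive_pgf e t : geometric_growth e -> is_derive t 1 (pgf e) (pgf (fdiff e) t).
Proof.
move=> ge; have h1 := is_derive_expRN t; have h2 := is_derive_egf t ge.
apply: (is_derive_eq (is_deriveM h1 h2)).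
by rewrite /pgf egf_fdiff // /GRing.scale /=; ring.
Qed.

(** Differentiate the functional equation m times and put t = 0.  It is only assumed
    for t > 0 since it will be obtained at t = z^2. *)
Lemma pgf_parity e (s : R) : s ^+ 2 = 1 -> geometric_growth e ->
  (forall t, 0 < t -> pgf e (- t) = s * pgf e t) ->
  forall m, iter m fdiff e 0%N = s * (-1) ^+ m * iter m fdiff e 0%N.
Proof.
move=> s2 ge h.
have all0 : forall t, pgf e (- t) = s * pgf e t.
  have neg t : t < 0 -> pgf e (- t) = s * pgf e t.
    move=> t0; have := h (- t); rewrite oppr_gt0 opprK => /(_ t0) ->.
    by rewrite mulrA -expr2 s2 mul1r.
  have c0 : continuous (pgf e).
    by move=> x; apply: differentiable_continuous; apply/derivable1_diffP; case: (is_derive_pgf x ge).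
  have lim : pgf e (- t) - s * pgf e t @[t --> 0^'+] --> pgf e (- 0) - s * pgf e 0.
    apply: cvg_at_right_filter; apply: cvgB.
      apply: (@continuous_comp _ _ _ (fun t : R => - t) (pgf e) 0); last exact: c0.
      by apply: cvgN; exact: cvg_id.
    by apply: cvgMr; exact: c0.
  have lim0 : pgf e (- t) - s * pgf e t @[t --> 0^'+] --> (0 : R).
    apply: cvg_near_cst; near=> t; apply/eqP; rewrite subr_eq0; apply/eqP; apply: h.
    by near: t; exact: nbhs_right_gt.
  move=> t; have [t0|t0|->] := ltgtP t 0; [exact: neg|exact: h|].
  by apply/eqP; rewrite -subr_eq0; apply/eqP; exact: cvg_unique lim lim0.
have step : forall m (e' : nat -> R) (r : R), geometric_growth e' ->
    (forall t, pgf e' (- t) = r * pgf e' t) ->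
    iter m fdiff e' 0%N = r * (-1) ^+ m * iter m fdiff e' 0%N.
  elim=> [|m IH] e' r ge' he'.
    by have := he' 0; rewrite oppr0 /pgf egf0 oppr0 expR0 mul1r expr0 mulr1.
  rewrite iterSr exprS mulN1r mulrN -mulNr; apply: IH; first exact: geometric_growth_fdiff.
  move=> t.
  have h1 : is_derive t 1 (fun x => pgf e' (- x)) (- pgf (fdiff e') (- t)).
    have hN : is_derive t 1 (fun x : R => - x) (- 1) by exact: is_deriveN.
    have := @is_derive1_comp _ (pgf e') (fun y => - y) t _ _ (is_derive_pgf _ ge') hN.
    by rewrite mulrN1.
  have h2 := is_derive_scale r (is_derive_pgf t ge').
  have E : (fun x => pgf e' (- x)) = (fun x => r * pgf e' x) :> (R -> R) by exact/funext.
  rewrite E in h1.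
  have : - pgf (fdiff e') (- t) = r * pgf (fdiff e') t.
    by case: h1 => _ <-; case: h2 => _ <-.
  by move/(congr1 -%R); rewrite opprK mulNr.
by move=> m; exact: step.
Unshelve. all: by end_near. Qed.

End ExponentialGeneratingFunctions.

(** * Self-adjointness of the transform *)

Section Swap.
Context {R : realType}.
Local Notation mu := (@lebesgue_measure R).

(** The transform is self-adjoint, by Fubini. *)
Lemma Int_swap (a : bool) (u v : R -> R) : subgauss u -> subgauss v ->
  Int (fun x => u x * Int (fun y => trig a (x * y) * v y)) =
  Int (fun y => v y * Int (fun x => trig a (y * x) * u x)).
Proof.
move=> su sv.
have mu_ : measurable_fun setT u by case: su.
have mv : measurable_fun setT v by case: sv.
pose K (z : R * R) : \bar R := (u z.1 * (trig a (z.1 * z.2) * v z.2))%:E.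
have mtrig : measurable_fun setT (fun z : R * R => trig a (z.1 * z.2)).
  have mm : measurable_fun setT (fun z : R * R => z.1 * z.2).
    by apply: measurable_funM; [exact: measurable_fst|exact: measurable_snd].
  have ct : measurable_fun setT (@trig R a).
    apply: continuous_measurable_fun => x; have := @continuous_trig R a 1 x.
    by rewrite (_ : (fun t => trig a (1 * t)) = trig a) //; apply/funext => t; rewrite mul1r.
  exact: measurableT_comp ct mm.
have mK : measurable_fun setT K.
  apply/measurable_EFinP; apply: measurable_funM.
    by apply: measurableT_comp mu_ _; exact: measurable_fst.
  by apply: measurable_funM => //; apply: measurableT_comp mv _; exact: measurable_snd.
have iu := subgauss_integrable su; have iv := subgauss_integrable sv.
have inner x : subgauss (fun y => u x * (trig a (x * y) * v y)).
  by apply: subgaussZ; apply: subgaussM => //; exact: subexp_trig.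
have iK : (mu \x mu)%E.-integrable setT K.
  have [_ +] := integrable12ltyP mu mu mK; apply.
  apply: (@le_lt_trans _ _ (\int[mu]_x (`|u x| * Int (fun y => `|v y|))%:E)%E).
    apply: ge0_le_integral => //.
    - by move=> x _; exact: integral_ge0.
    - have := @measurable_fun_fubini_tonelli_F _ _ _ _ R mu (abse \o K).
      have mK' := measurableT_comp (@abse_measurable R setT) mK.
      by move=> /(_ mK') h; apply: h => z; exact: abse_ge0.
    - by apply/measurable_EFinP; apply: measurable_funM => //; exact: measurableT_comp.
    - move=> x _.
      rewrite EFinM /Int /Rintegral fineK; last first.
        by apply: integrable_fin_num => //; exact: subgauss_integrable (subgauss_norm sv).
      rewrite -integralZl //; last exact: subgauss_integrable (subgauss_norm sv).
      apply: ge0_le_integral => //.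
      + have := measurableT_comp (@normr_measurable R setT) (subgauss_measurable (inner x)).
        by move/measurable_EFinP.
      + by apply/measurable_EFinP; apply: measurable_funM => //; exact: measurableT_comp.
      + move=> y _ /=; rewrite lee_fin !normrM ler_wpM2l // ler_piMl //.
        exact: norm_trig_le1.
  under eq_integral do rewrite EFinM muleC.
  rewrite integralZl //; last exact: subgauss_integrable (subgauss_norm su).
  have := integrable_fin_num measurableT (subgauss_integrable (subgauss_norm su)).
  move=> /fineK <-; rewrite -EFinM; exact: ltry.
have := Fubini iK.
rewrite /K /= => F; rewrite /Int {1 3}/Rintegral.
have E1 x : (\int[mu]_y (u x * (trig a (x * y) * v y))%:E)%E =
    (u x * Int (fun y => trig a (x * y) * v y))%:E.
  rewrite -IntZ; last by apply: subgaussM => //; exact: subexp_trig.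
  rewrite /Int /Rintegral fineK //.
  by apply: integrable_fin_num => //; exact: subgauss_integrable (inner x).
have E2 y : (\int[mu]_x (u x * (trig a (x * y) * v y))%:E)%E =
    (v y * Int (fun x => trig a (y * x) * u x))%:E.
  have s2 : subgauss (fun x => v y * (trig a (y * x) * u x)).
    by apply: subgaussZ; apply: subgaussM => //; exact: subexp_trig.
  rewrite -IntZ; last by apply: subgaussM => //; exact: subexp_trig.
  rewrite /Int /Rintegral fineK; last first.
    by apply: integrable_fin_num => //; exact: subgauss_integrable.
  by apply: eq_integral => x _; congr EFin; rewrite [y * x]mulrC; ring.
congr fine; transitivity (\int[mu]_x \int[mu]_y (u x * (trig a (x * y) * v y))%:E)%E.
  by apply: eq_integral => x _; rewrite E1.
by rewrite F; apply: eq_integral => x _; rewrite E2.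
Qed.

End Swap.

(** * Gaussian means and Hermite polynomials *)

Section Hermite.
Context {R : realType}.
Implicit Types (p q : {poly R}).

Definition gauss (x : R) : R := gauss2 x * gauss2 x.

Lemma gaussE x : gauss x = expR (- x ^+ 2).
Proof. by rewrite /gauss /gauss2 -expRD; congr expR; field. Qed.

Lemma subgauss_gauss : subgauss gauss.
Proof. by apply: subgaussM; [exact: subexp_gauss2|exact: subgauss_gauss2]. Qed.

Definition gmean p := Int (fun x => p.[x] * gauss x).

Lemma subgauss_horner_gauss p : subgauss (fun x => p.[x] * gauss x).
Proof. by apply: subgaussM; [exact: subexp_horner|exact: subgauss_gauss]. Qed.

Lemma gmeanD p q : gmean (p + q) = gmean p + gmean q.
Proof.
rewrite /gmean -IntD; try exact: subgauss_horner_gauss.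
by apply: eq_Int => x; rewrite hornerD mulrDl.
Qed.

Lemma gmeanZ (c : R) p : gmean (c *: p) = c * gmean p.
Proof.
rewrite /gmean -IntZ; last exact: subgauss_horner_gauss.
by apply: eq_Int => x; rewrite hornerZ; ring.
Qed.

Lemma gmeanB p q : gmean (p - q) = gmean p - gmean q.
Proof. by rewrite -scaleN1r gmeanD gmeanZ mulN1r. Qed.

Lemma gmean0 : gmean 0 = 0.
Proof. by rewrite -(scale0r (0 : {poly R})) gmeanZ mul0r. Qed.

Lemma gmean1 : gmean 1 = Num.sqrt pi.
Proof.
rewrite /gmean /Int /Rintegral -[RHS]/(fine (Num.sqrt pi)%:E) -integralT_gauss.
by congr fine; apply: eq_integral => x _; rewrite hornerC mul1r gaussE.
Qed.

(** Integration by parts of p times [gauss2] against [gauss2]. *)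
Lemma gmean_deriv p : gmean p^`() = gmean (2 *: ('X * p)).
Proof.
pose v x := p.[x] * gauss2 x.
pose dv x := p^`().[x] * gauss2 x - x * p.[x] * gauss2 x.
have sg := @subexp_gauss2 R.
have h : Int (fun x => x * v x * gauss2 x) = Int (fun x => dv x * gauss2 x).
  apply: (@Int_by_parts _ v dv).
  - move=> x; have h1 := is_derive_poly p x; have h2 := @is_derive_gauss2 R x.
    apply: (is_derive_eq (is_deriveM h1 h2)).
    by rewrite /GRing.scale /= /dv; ring.
  - move=> x; apply: cvgB; apply: cvgM.
    + exact: continuous_horner.
    + exact: continuous_gauss2.
    + by apply: cvgM; [exact: cvg_id|exact: continuous_horner].
    + exact: continuous_gauss2.
  - by apply: subexpM => //; exact: subexp_horner.
  - rewrite (_ : dv = fun x => p^`().[x] * gauss2 x + (- 1) * (x * p.[x] * gauss2 x)).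
      apply: subexpD; first by apply: subexpM => //; exact: subexp_horner.
      apply: subexpM; first exact: subexp_cst.
      by apply: subexpM => //; apply: subexpM; [exact: subexp_id|exact: subexp_horner].
    by apply/funext => x; rewrite /dv mulN1r.
have e1 : Int (fun x => x * v x * gauss2 x) = gmean ('X * p).
  by apply: eq_Int => x; rewrite hornerM hornerX /v /gauss; ring.
have e2 : Int (fun x => dv x * gauss2 x) = gmean (p^`() - 'X * p).
  by apply: eq_Int => x; rewrite hornerD hornerN hornerM hornerX /dv /gauss; ring.
move: h; rewrite e1 e2 gmeanB gmeanZ => h.
by rewrite -[LHS](subrK (gmean ('X * p))) -h; ring.
Qed.

Fixpoint herm n : {poly R} :=
  if n is m.+1 then 2 *: ('X * herm m) - (herm m)^`() else 1.

(** The operator p |-> 2 X p - p' that generates the Hermite polynomials is adjoint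
    to the derivative, by [gmean_deriv]. *)
Lemma gmean_herm n q : gmean (herm n * q) = gmean q^`(n).
Proof.
elim: n q => [|n IH] q; first by rewrite mul1r derivn0.
rewrite derivSn -IH /= mulrBl gmeanB -scalerAl -mulrA -gmean_deriv derivM gmeanD.
by rewrite addrC addKr.
Qed.

Lemma size_lead_herm n : size (herm n) = n.+1 /\ lead_coef (herm n) = 2 ^+ n.
Proof.
elim: n => [|n [IHs IHl]]; first by rewrite size_poly1 lead_coef1.
have n0 : herm n != 0 by rewrite -size_poly_eq0 IHs.
have s1 : size (2 *: ('X * herm n)) = n.+2.
  by rewrite size_scale ?pnatr_eq0 // mulrC size_mulX // IHs.
have s2 : (size (- (herm n)^`()) < size (2%:R *: ('X * herm n)))%N.
  by rewrite size_polyN s1 (leq_trans (lt_size_deriv n0)) // IHs.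
rewrite /= size_polyDl // lead_coefDl // s1; split => //.
by rewrite lead_coefZ ['X * _]mulrC lead_coefMX IHl exprS.
Qed.

Lemma derivn_size (q : {poly R}) n : (size q <= n.+1)%N -> q^`(n) = (q`_n *+ n`!)%:P.
Proof.
move=> sq; apply/polyP => i; rewrite coef_derivn coefC.
case: i => [|i] /=; first by rewrite addn0 ffactnn.
rewrite nth_default ?mul0rn //; apply: leq_trans sq _; lia.
Qed.

Lemma gmean_herm_top n q : (size q <= n.+1)%N ->
  gmean (herm n * q) = q`_n * n`!%:R * Num.sqrt pi.
Proof.
move=> sq; rewrite gmean_herm derivn_size //.
by rewrite -[_%:P]mulr1 mul_polyC gmeanZ gmean1 mulr_natr.
Qed.

Lemma gmean_Xn2 k : gmean ('X^(k.+2)) = k.+1%:R / 2 * gmean ('X^k).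
Proof.
have := gmean_deriv ('X^(k.+1)).
rewrite derivXn /= -exprS gmeanZ -[_ *+ _]scaler_nat gmeanZ => h.
by apply: (@mulfI _ 2) => //; rewrite -h; field.
Qed.

Definition evenmom j : R := gmean ('X^(j.*2)).

Lemma evenmomS j : evenmom j.+1 = (j%:R + 2^-1) * evenmom j.
Proof.
rewrite /evenmom doubleS gmean_Xn2; congr (_ * _).
by rewrite -natr1 -mul2n natrM; field.
Qed.

Lemma evenmomE j : evenmom j = Num.sqrt pi * (j.*2`!%:R / (2 ^+ j.*2 * j`!%:R)).
Proof.
elim: j => [|j IH].
  by rewrite /evenmom expr0 gmean1 double0 fact0 expr0 mulr1 divr1 mulr1.
rewrite evenmomS IH doubleS !factS !natrM !exprS.
have -> : j.*2.+2%:R = 2 * j.+1%:R :> R by rewrite -natrM mul2n doubleS.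
have -> : j.*2.+1%:R = 2 * j%:R + 1 :> R by rewrite -natr1 -mul2n natrM.
by field; rewrite nat1r !pnatr_eq0 -!lt0n fact_gt0 expf_neq0.
Qed.

Lemma evenmom_ge0 j : 0 <= evenmom j.
Proof. by rewrite evenmomE mulr_ge0 ?sqrtr_ge0 // divr_ge0 // mulr_ge0 // exprn_ge0. Qed.

Lemma evenmom_le j K : evenmom (j + K) <= evenmom j * (K.+1 * j.+1)%:R ^+ K.
Proof.
suff P i : (i <= K)%N -> evenmom (j + i) <= evenmom j * (K.+1 * j.+1)%:R ^+ i by exact: P.
elim: i => [|i IH] iK; first by rewrite addn0 expr0 mulr1.
rewrite addnS evenmomS exprS mulrCA; apply: ler_pM.
- by rewrite addr_ge0.
- exact: evenmom_ge0.
- apply: (@le_trans _ _ (j + i).+1%:R); first by rewrite -[(j + i).+1%:R]natr1; lra.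
  by rewrite ler_nat; nia.
- exact: IH (ltnW iK).
Qed.

End Hermite.

(** * Hardy's theorem for eigenfunctions *)

Section Hardy.
Context {R : realType}.
Implicit Types (a : bool) (w f : R -> R) (p q : {poly R}).

Definition moment_scale a j : R := j`!%:R * 2 ^+ (j.*2 + a) / (j.*2 + a)`!%:R.

(** The scaling is chosen so that the exponential generating function of these
    coefficients at t = z^2 is z^(-a) times the integral of hyp(2zx) w(x)
    ([egf_moment_coef_hyp]), and so that they grow polynomially when w is
    e^(-x^2) times a polynomially bounded function. *)
Definition moment_coef a w j := moment_scale a j * Int (fun x => x ^+ (j.*2 + a) * w x).

Lemma moment_scale_ge0 a j : 0 <= moment_scale a j.
Proof. by rewrite divr_ge0 // mulr_ge0 // exprn_ge0. Qed.

Lemma moment_scale_evenmom a j : moment_scale a j * evenmom j <= 2 * Num.sqrt pi.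
Proof.
have E : moment_scale false j * evenmom j = Num.sqrt pi.
  rewrite /moment_scale addn0 evenmomE.
  by field; rewrite !pnatr_eq0 -!lt0n !fact_gt0 expf_neq0.
case: a; last by rewrite E ler_peMl ?sqrtr_ge0 //; lra.
rewrite -E mulrA ler_wpM2r ?evenmom_ge0 //.
have -> : moment_scale true j = 2 / (j.*2.+1)%:R * moment_scale false j.
  rewrite /moment_scale addn1 addn0 factS natrM exprS.
  by field; rewrite nat1r !pnatr_eq0 -lt0n fact_gt0.
by rewrite ler_wpM2r ?moment_scale_ge0 // ler_pdivrMr ?ltr0n // ler_peMr // ler1n.
Qed.

(** [gmean_herm] turns the left-hand side into a falling factorial times an even
    Gaussian moment.  As functions of j these are binomials, the sequences with
    a single nonzero difference at 0. *)
Lemma herm_moment a l j : moment_scale a j * gmean (herm (l.*2 + a) * 'X^(j.*2 + a)) =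
  Num.sqrt pi * 2 ^+ (l.*2 + a) * l`!%:R * 'C(j, l)%:R.
Proof.
rewrite gmean_herm derivnXn -scaler_nat gmeanZ.
have [lj|jl] := leqP l j; last first.
  rewrite bin_small // ffact_small; first by rewrite !mul0r !mulr0.
  by rewrite ltn_add2r ltn_double.
have le2 : (l.*2 + a <= j.*2 + a)%N by rewrite leq_add2r leq_double.
have -> : (j.*2 + a - (l.*2 + a) = (j - l).*2)%N by rewrite subnDr doubleB.
rewrite -/(evenmom _) evenmomE.
have h1 := ffact_fact le2; have h2 := bin_fact lj.
rewrite subnDr -doubleB in h1.
have {}h1 : ((j.*2 + a) ^_ (l.*2 + a))%N%:R * ((j - l).*2)`!%:R = (j.*2 + a)`!%:R :> R.
  by rewrite -natrM h1.
have {}h2 : 'C(j, l)%:R * (l`!%:R * (j - l)`!%:R) = j`!%:R :> R by rewrite -!natrM h2.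
have e2 : 2 ^+ (j.*2 + a) = 2 ^+ (l.*2 + a) * 2 ^+ (j - l).*2 :> R.
  by rewrite -exprD; congr (_ ^+ _); rewrite -{1}(subnK lj) doubleD; ring.
rewrite /moment_scale -h1 -h2 e2.
have f1 : ((j.*2 + a) ^_ (l.*2 + a))%N%:R != 0 :> R by rewrite pnatr_eq0 -lt0n ffact_gt0.
by field; rewrite f1 !pnatr_eq0 -!lt0n !fact_gt0 expf_neq0.
Qed.

(** Pascal's rule for the binomials against e_(j+1) = e_j + (D e)_j. *)
Lemma newton e n j : (j < n)%N ->
  e j = \sum_(m < n) 'C(j, m)%:R * iter m (@fdiff R) e 0%N.
Proof.
elim: j n e => [|j IH] [//|n] e jn.
  rewrite big_ord_recl bin0 mul1r big1 ?addr0 // => i _.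
  by rewrite bin_small // mul0r.
have := IH n.+1 e (ltnW jn); have := IH n (fdiff e) jn => h1 h2.
have -> : e j.+1 = e j + fdiff e j by rewrite /fdiff; ring.
rewrite h1 h2 !big_ord_recl !bin0 -addrA; congr (_ + _).
rewrite -big_split /=; apply: eq_bigr => i _.
by rewrite /bump /= !add1n binS natrD mulrDl -iterSr.
Qed.

(** The scaled moments of e^(-x^2) itself are bounded ([moment_scale_evenmom]), and
    each extra factor x^2 in the integrand costs one factor linear in j
    ([evenmom_le]). *)
Lemma moment_coef_bound a f (C : R) M : 0 <= C -> subgauss f ->
  (forall x, `|f x| <= C * (1 + x ^+ 2) ^+ M * gauss2 x) ->
  exists2 D, 0 <= D & poly_growth M.+1 D (moment_coef a (fun x => gauss2 x * f x)).
Proof.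
move=> C0 sf hf.
set K := M.+1.
exists (2 * Num.sqrt pi * C * 2 ^+ K * (1 + K.+1%:R ^+ K)).
  by rewrite !mulr_ge0 ?sqrtr_ge0 ?exprn_ge0 // addr_ge0 // exprn_ge0.
move=> j; rewrite normrM ger0_norm ?moment_scale_ge0 //.
have sw : subgauss (fun x => x ^+ (j.*2 + a) * (gauss2 x * f x)).
  apply: subgaussM; first exact: subexp_pow.
  by apply: subgaussM => //; exact: subexp_gauss2.
(* |x^a| <= 1 + x^2 absorbs the parity factor, so the exponent rises from M to
   K = M + 1; then (1 + x^2)^K <= 2^K (1 + x^(2K)). *)
pose h := C * 2 ^+ K *: ('X^(j.*2) + 'X^((j + K).*2)) : {poly R}.
have b1 : `|Int (fun x => x ^+ (j.*2 + a) * (gauss2 x * f x))| <= gmean h.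
  apply: norm_Int_le => //; first exact: subgauss_horner_gauss.
  move=> x; rewrite hornerZ hornerD !hornerXn !normrM.
  rewrite [`|gauss2 x|]ger0_norm ?expR_ge0 // /gauss.
  have x2 : 0 <= x ^+ 2 := sqr_ge0 x.
  have ha2 : `|x ^+ a| <= 1 + x ^+ 2.
    case: (a); last by rewrite expr0 normr1 lerDl.
    have := sqr_ge0 (`|x| - 1); have := normr_ge0 x; have := real_normK (num_real x).
    by rewrite expr1 => <-; nra.
  have ha : `|x ^+ (j.*2 + a)| <= x ^+ j.*2 * (1 + x ^+ 2).
    rewrite exprD normrM -mul2n exprM.
    rewrite ger0_norm; last exact: exprn_ge0.
    by apply: ler_wpM2l => //; exact: exprn_ge0.
  have hK : (1 + x ^+ 2) ^+ K <= 2 ^+ K * (1 + (x ^+ 2) ^+ K).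
    have [x1|x1] := leP (x ^+ 2) 1.
      apply: (@le_trans _ _ (2 ^+ K)).
        by apply: lerXn2r; rewrite ?nnegrE; lra.
      by rewrite ler_peMr ?exprn_ge0 // lerDl exprn_ge0.
    apply: (@le_trans _ _ ((2 * x ^+ 2) ^+ K)).
      by apply: lerXn2r; rewrite ?nnegrE; lra.
    by rewrite exprMn ler_wpM2l ?exprn_ge0 // lerDr.
  apply: (@le_trans _ _ ((x ^+ j.*2 * (1 + x ^+ 2)) *
      (gauss2 x * (C * (1 + x ^+ 2) ^+ M * gauss2 x)))).
    apply: ler_pM => //; first by rewrite mulr_ge0 // expR_ge0.
    by rewrite ler_wpM2l ?expR_ge0.
  rewrite doubleD exprD -!mul2n !(exprM x).
  have -> : (x ^+ 2) ^+ j * (1 + x ^+ 2) * (gauss2 x * (C * (1 + x ^+ 2) ^+ M * gauss2 x)) =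
    C * (x ^+ 2) ^+ j * (gauss2 x * gauss2 x) * (1 + x ^+ 2) ^+ K by rewrite /K [(1 + x ^+ 2) ^+ M.+1]exprS; ring.
  have -> : C * 2 ^+ K * ((x ^+ 2) ^+ j + (x ^+ 2) ^+ j * (x ^+ 2) ^+ K) * (gauss2 x * gauss2 x) =
    C * (x ^+ 2) ^+ j * (gauss2 x * gauss2 x) * (2 ^+ K * (1 + (x ^+ 2) ^+ K)) by ring.
  apply: ler_wpM2l => //; apply: mulr_ge0; last by apply: mulr_ge0; exact: expR_ge0.
  by apply: mulr_ge0 => //; exact: exprn_ge0.
apply: le_trans (ler_wpM2l (moment_scale_ge0 a j) b1) _.
rewrite /h gmeanZ gmeanD -!/(evenmom _).
have c0 : 0 <= C * 2 ^+ K by rewrite mulr_ge0 // exprn_ge0.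
apply: (@le_trans _ _ (C * 2 ^+ K * (moment_scale a j * evenmom j * (1 + (K.+1 * j.+1)%:R ^+ K)))).
  rewrite mulrCA ler_wpM2l // -mulrA ler_wpM2l ?moment_scale_ge0 // mulrDr mulr1 lerD2l.
  exact: evenmom_le.
rewrite natrM exprMn.
apply: (@le_trans _ _ (C * 2 ^+ K * (2 * Num.sqrt pi * ((1 + K.+1%:R ^+ K) * j.+1%:R ^+ K)))).
  rewrite ler_wpM2l //; apply: ler_pM.
  - by rewrite mulr_ge0 ?moment_scale_ge0 // evenmom_ge0.
  - by rewrite addr_ge0 // mulr_ge0 ?exprn_ge0.
  - exact: moment_scale_evenmom.
  - by rewrite mulrDl mul1r lerD2r exprn_ege1 // ler1n.
by rewrite le_eqVlt; apply/orP; left; apply/eqP; ring.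
Qed.

Lemma egf_moment_coef_hyp a w (z : R) : subgauss w -> geometric_growth (moment_coef a w) ->
  z ^+ a * egf (moment_coef a w) (z ^+ 2) = Int (fun x => hyp a (2 * z * x) * w x).
Proof.
move=> sw gw; have h := @Int_hyp_series R a (2 * z) w sw.
have h2 : z ^+ a * pseries (fun j => moment_coef a w j / j`!%:R) (z ^+ 2) n @[n --> \oo] -->
    z ^+ a * egf (moment_coef a w) (z ^+ 2) by apply: cvgMr; exact: cvg_egf.
have E : (fun n => z ^+ a * pseries (fun j => moment_coef a w j / j`!%:R) (z ^+ 2) n) =
  (fun n => \sum_(j < n) (2 * z) ^+ (j.*2 + a) / (j.*2 + a)`!%:R *
     Int (fun x => x ^+ (j.*2 + a) * w x)) :> (nat -> R).
  apply/funext => n; rewrite /pseries /series /= big_mkord mulr_sumr; apply: eq_bigr => j _.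
  have ez : z ^+ (j.*2 + a) = (z ^+ 2) ^+ j * z ^+ a by rewrite exprD -mul2n exprM.
  rewrite /moment_coef /moment_scale [(2 * z) ^+ _]exprMn ez.
  by field; rewrite !pnatr_eq0 -!lt0n !fact_gt0.
by rewrite E in h2; exact: cvg_unique h2 h.
Qed.

(** The same series as in [egf_moment_coef_hyp], at the imaginary argument iz. *)
Lemma egf_moment_coef_trig a w (z : R) : subgauss w -> geometric_growth (moment_coef a w) ->
  z ^+ a * egf (moment_coef a w) (- z ^+ 2) = Int (fun x => trig a (2 * z * x) * w x).
Proof.
move=> sw gw; have h := @Int_trig_series R a (2 * z) w sw.
have h2 : z ^+ a * pseries (fun j => moment_coef a w j / j`!%:R) (- z ^+ 2) n @[n --> \oo] -->
    z ^+ a * egf (moment_coef a w) (- z ^+ 2) by apply: cvgMr; exact: cvg_egf.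
have E : (fun n => z ^+ a * pseries (fun j => moment_coef a w j / j`!%:R) (- z ^+ 2) n) =
  (fun n => \sum_(j < n) (-1) ^+ j * (2 * z) ^+ (j.*2 + a) / (j.*2 + a)`!%:R *
     Int (fun x => x ^+ (j.*2 + a) * w x)) :> (nat -> R).
  apply/funext => n; rewrite /pseries /series /= big_mkord mulr_sumr; apply: eq_bigr => j _.
  have ez : z ^+ (j.*2 + a) = (z ^+ 2) ^+ j * z ^+ a by rewrite exprD -mul2n exprM.
  have en : (- z ^+ 2) ^+ j = (-1) ^+ j * (z ^+ 2) ^+ j by rewrite -exprMn mulN1r.
  rewrite /moment_coef /moment_scale [(2 * z) ^+ _]exprMn ez en.
  by field; rewrite !pnatr_eq0 -!lt0n !fact_gt0.
by rewrite E in h2; exact: cvg_unique h2 h.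
Qed.

Lemma Int_horner_trig_gauss2 q a : exists p, forall y,
  Int (fun x => q.[x] * trig a (y * x) * gauss2 x) = p.[y] * gauss2 y.
Proof.
have sg l b (y : R) (r : {poly R}) : subgauss (fun x => x ^+ l * r.[x] * trig b (y * x) * gauss2 x).
  apply: subgaussM; last exact: subgauss_gauss2.
  apply: subexpM; last exact: subexp_trig.
  by apply: subexpM; [exact: subexp_pow|exact: subexp_horner].
suff P l : exists p, forall y,
    Int (fun x => x ^+ l * q.[x] * trig a (y * x) * gauss2 x) = p.[y] * gauss2 y.
  have [p hp] := P 0%N; exists p => y; rewrite -hp.
  by apply: eq_Int => x; rewrite expr0 mul1r.
elim/poly_ind: q l => [|q c IH] l.
  exists 0 => y; rewrite horner0 mul0r -[RHS](@Int0 R).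
  by apply: eq_Int => x; rewrite horner0 mulr0 !mul0r.
have [p1 h1] := IH l.+1; have [p2 h2] := @Int_pow_trig_gauss2 R l a.
exists (p1 + c *: p2) => y; rewrite hornerD hornerZ mulrDl -mulrA -h1 -h2.
have s2 : subgauss (fun x : R => x ^+ l * trig a (y * x) * gauss2 x).
  have := sg l a y 1; rewrite (_ : (fun x => _) = fun x => x ^+ l * trig a (y * x) * gauss2 x) //.
  by apply/funext => x; rewrite hornerC mulr1.
rewrite -IntZ // -IntD //; last exact: subgaussZ.
by apply: eq_Int => x; rewrite hornerMXaddC exprS; ring.
Qed.

(** Let b = 2z with z^2 = t.  Pairing the eigenvalue equation with
    trig(bx) e^(-x^2/2) and moving the transform to that factor, where
    [Int_trig_trig_gauss2] evaluates it, gives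
    \int trig(bx) w = s e^(-b^2/2) \int hyp(bx) w for w = e^(-x^2/2) f.  By
    [egf_moment_coef_trig] and [egf_moment_coef_hyp] this says
    A(-t) = s e^(-2t) A(t) for the exponential generating function A of the
    coefficients. *)
Lemma moment_coef_parity a f (s : R) : s ^+ 2 = 1 -> subgauss f ->
  (forall x, f x = s / Num.sqrt (2 * pi) * Int (fun y => trig a (x * y) * f y)) ->
  let e := moment_coef a (fun x => gauss2 x * f x) in geometric_growth e ->
  forall m, iter m (@fdiff R) e 0%N = s * (-1) ^+ m * iter m (@fdiff R) e 0%N.
Proof.
move=> s2 sf hf; set w := fun x => gauss2 x * f x.
move=> e ge; apply: pgf_parity => // t t0.
have sw : subgauss w by apply: subgaussM => //; exact: subexp_gauss2.
pose z := Num.sqrt t; have z0 : 0 < z by rewrite sqrtr_gt0.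
have z2 : z ^+ 2 = t by rewrite sqr_sqrtr // ltW.
pose b := 2 * z.
have r0 : Num.sqrt (2 * pi) != 0 :> R by rewrite gt_eqF // sqrtr_gt0 mulr_gt0 // pi_gt0.
have key : Int (fun x => trig a (b * x) * w x) =
    s * gauss2 b * Int (fun x => hyp a (b * x) * w x).
  pose u x := trig a (b * x) * gauss2 x.
  have su : subgauss u.
    by apply: subgaussM; [exact: subexp_trig|exact: subgauss_gauss2].
  have sm v : subexp v -> subgauss (fun x => v x * w x) by move=> sv; exact: subgaussM.
  have := @Int_swap _ a u f su sf.
  have -> : (fun x => u x * Int (fun y => trig a (x * y) * f y)) =
      (fun x => Num.sqrt (2 * pi) * s * (trig a (b * x) * w x)).
    apply/funext => x; rewrite /u /w hf.
    set I := Int _.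
    transitivity (s ^+ 2 * (trig a (b * x) * gauss2 x * I)); first by rewrite s2 mul1r.
    by field.
  have -> : (fun y => f y * Int (fun x => trig a (y * x) * u x)) =
      (fun y => Num.sqrt (2 * pi) * gauss2 b * (hyp a (b * y) * w y)).
    by apply/funext => y; rewrite /u Int_trig_trig_gauss2 /w; ring.
  rewrite !IntZ; [|by apply: sm; exact: subexp_hyp|by apply: sm; exact: subexp_trig].
  rewrite -!mulrA => /(mulfI r0) h.
  by rewrite -[LHS]mul1r -s2 expr2 -!mulrA h.
have := @egf_moment_coef_hyp a w z sw ge; have := @egf_moment_coef_trig a w z sw ge.
rewrite -/b key z2 -/e => h1 h2; rewrite -h2 in h1.
have za : z ^+ a != 0 by rewrite expf_neq0 // gt_eqF.
apply: (mulfI za); rewrite /pgf opprK mulrCA h1.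
have -> : expR t * (s * gauss2 b * (z ^+ a * egf e t)) =
  s * (expR t * gauss2 b) * (z ^+ a * egf e t) by ring.
have -> : expR t * gauss2 b = expR (- t).
  by rewrite /gauss2 -expRD /b exprMn z2; congr expR; field.
by ring.
Qed.

(** For s = 1 the odd differences vanish and [odd_flat_vanish] applies to the even
    differences of [e]; for s = -1 the even ones vanish and it applies to those of
    [fdiff e]. *)
Lemma differences_vanish e M (C s : R) : s ^+ 2 = 1 -> 0 <= C -> poly_growth M C e ->
  (forall m, iter m fdiff e 0%N = s * (-1) ^+ m * iter m fdiff e 0%N) ->
  exists N, forall m, (N <= m)%N -> iter m fdiff e 0%N = 0.
Proof.
have flat e' (C' : R) : 0 <= C' -> poly_growth M C' e' -> odd_flat e' ->
    forall m, (2 * M.+1 <= m)%N -> iter m fdiff e' 0%N = 0.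
  move=> C0 be fe m hm; have [om|em] := boolP (odd m); first exact: fe.
  rewrite -(subnK hm) addnC iterD; apply: (odd_flat_vanish (M := M)
    (C := (1 + 2 ^+ M) ^+ (m - 2 * M.+1) * C')).
  - by rewrite mulr_ge0 ?exprn_ge0 ?addr_ge0 ?exprn_ge0.
  - exact: poly_growth_iter_fdiff.
  - by apply: odd_flat_iter_fdiff fe; rewrite oddB // oddM addbF.
move=> /eqP; rewrite sqrf_eq1 => /orP[] /eqP -> C0 be h.
  exists (2 * M.+1)%N; apply: flat C0 be _ => m om.
  by have := h m; rewrite mul1r -signr_odd om expr1 mulN1r; lra.
exists (2 * M.+1).+1 => -[//|m] hm; rewrite iterSr.
apply: (flat _ ((1 + 2 ^+ M) * C)) => //.
- by rewrite mulr_ge0 // addr_ge0 // exprn_ge0.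
- exact: poly_growth_fdiff.
- move=> k ok; rewrite -iterSr; have := h k.+1.
  by rewrite -signr_odd /= ok expr0 mulr1 mulN1r; lra.
Qed.

Lemma exp_partial_le (z : R) n : 0 <= z -> \sum_(i < n) z ^+ i / i`!%:R <= expR z.
Proof.
move=> z0; have h := @is_cvg_series_exp_coeff R z.
have nd : nondecreasing_seq (series (exp_coeff z)).
  by apply/nondecreasing_seqP => k; rewrite seriesSr lerDl; exact: exp_coeff_ge0.
by have := nondecreasing_cvgn_le nd h n; rewrite -/(expR z) /series /= big_mkord.
Qed.

(** Expanding 1 = e^(x^2/2) e^(-x^2/2) in powers of x^2/2 removes the weight from
    the hypothesis: the moments of f itself vanish.  The series of trig then gives
    the conclusion. *)
Lemma moments_vanish a f : subgauss f ->
  (forall j, Int (fun x => x ^+ (j.*2 + a) * (gauss2 x * f x)) = 0) ->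
  forall y, Int (fun x => trig a (y * x) * f x) = 0.
Proof.
move=> sf h0.
have m0 k : Int (fun x => x ^+ (k.*2 + a) * f x) = 0.
  pose g x := x ^+ (k.*2 + a) * f x.
  have sg : subgauss g by apply: subgaussM => //; exact: subexp_pow.
  pose u i x := (x ^+ 2 / 2) ^+ i / i`!%:R * (gauss2 x * g x).
  have suj i : subgauss (fun x => x ^+ ((i + k).*2 + a) * (gauss2 x * f x)).
    apply: subgaussM; first exact: subexp_pow.
    by apply: subgaussM => //; exact: subexp_gauss2.
  have uE i : u i = fun x => (2 ^+ i * i`!%:R)^-1 * (x ^+ ((i + k).*2 + a) * (gauss2 x * f x)).
    apply/funext => x; have e1 : (x ^+ 2 / 2) ^+ i = x ^+ i.*2 / 2 ^+ i by rewrite -mul2n exprM -expr_div_n.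
    rewrite /u /g doubleD -addnA [x ^+ (i.*2 + _)]exprD e1.
    by field; rewrite !pnatr_eq0 -!lt0n fact_gt0 expf_neq0.
  have su i : subgauss (u i) by rewrite uE; exact: subgaussZ.
  have Iu i : Int (u i) = 0 by rewrite uE IntZ // h0 mulr0.
  have sE n x : \sum_(i < n) u i x = (\sum_(i < n) (x ^+ 2 / 2) ^+ i / i`!%:R) * (gauss2 x * g x).
    by rewrite mulr_suml.
  have ge (x : R) : expR (x ^+ 2 / 2) * gauss2 x = 1.
    by rewrite /gauss2 -expRD subrr expR0.
  have lim : \sum_(i < n) Int (u i) @[n --> \oo] --> Int g.
    apply: (@Int_series _ u g (fun x => `|g x|)) => //.
    - by case: sg.
    - exact: subgauss_norm.
    - move=> n x; rewrite sE !normrM.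
      have x2 : 0 <= x ^+ 2 / 2 by rewrite divr_ge0 // sqr_ge0.
      rewrite mulrA ler_piMl // [`|gauss2 x|]ger0_norm ?expR_ge0 //.
      rewrite ger0_norm; last by apply: sumr_ge0 => i _; rewrite divr_ge0 // exprn_ge0.
      apply: (@le_trans _ _ (expR (x ^+ 2 / 2) * gauss2 x)); last by rewrite ge.
      by apply: ler_wpM2r; [exact: expR_ge0|exact: exp_partial_le].
    - move=> x; have hx : g x = expR (x ^+ 2 / 2) * (gauss2 x * g x) by rewrite mulrA ge mul1r.
      rewrite [X in _ --> X]hx; set v := (X in X @ _ --> _).
      have -> : v = (fun n => series (exp_coeff (x ^+ 2 / 2)) n * (gauss2 x * g x)) :> (nat -> R).
        by apply/funext => n; rewrite /v sE /series /= big_mkord.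
      by apply: cvgMl; exact: is_cvg_series_exp_coeff.
  have lim0 : \sum_(i < n) Int (u i) @[n --> \oo] --> (0 : R).
    set v := (X in X @ _ --> _).
    have -> : v = (fun=> 0) :> (nat -> R); last exact: cvg_cst.
    by apply/funext => n; rewrite /v big1.
  exact: cvg_unique lim lim0.
move=> y; have h := @Int_trig_series R a y f sf.
have h2 : \sum_(j < n) (-1) ^+ j * y ^+ (j.*2 + a) / (j.*2 + a)`!%:R *
    Int (fun x => x ^+ (j.*2 + a) * f x) @[n --> \oo] --> (0 : R).
  set v := (X in X @ _ --> _).
  have -> : v = (fun=> 0) :> (nat -> R); last exact: cvg_cst.
  by apply/funext => n; rewrite /v big1 // => j _; rewrite m0 mulr0.
exact: cvg_unique h h2.
Qed.

(** The differences of the moment coefficients at 0 vanish from some N on.  The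
    combination q of Hermite polynomials with these differences as coefficients
    has the same moments as f, hence the same transform. *)
Theorem hardy_eigenfunction a f (s C : R) M : s ^+ 2 = 1 -> 0 <= C -> measurable_fun setT f ->
  (forall x, `|f x| <= C * (1 + x ^+ 2) ^+ M * gauss2 x) ->
  (forall x, f x = s / Num.sqrt (2 * pi) * Int (fun y => trig a (x * y) * f y)) ->
  exists p, forall x, f x = p.[x] * gauss2 x.
Proof.
move=> s2 C0 mf bf hf.
have sf : subgauss f.
  have [_ [A [b [A0 b0 hA]]]] : subexp (fun x : R => (1 + x ^+ 2) ^+ M).
    apply: subexpX; apply: subexpD; [exact: subexp_cst|exact: subexp_pow].
  split=> //; exists (C * A), b; split; rewrite ?mulr_ge0 // => x.
  apply: le_trans (bf x) _; rewrite expRD mulrA ler_wpM2r ?expR_ge0 // -mulrA ler_wpM2l //.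
  by apply: le_trans (hA x); rewrite ler_norm.
have [D D0 bD] := moment_coef_bound a C0 sf bf.
set w := fun x => gauss2 x * f x in bD; set e := moment_coef a w in bD.
have ge := poly_growth_geometric_growth D0 bD.
have par := moment_coef_parity s2 sf hf ge.
have [N hN] := differences_vanish s2 D0 bD par.
(* The coefficients invert [herm_moment]: q has scaled moments
   sum_m (D^m e)_0 C(j, m) = e_j. *)
pose c m : R := iter m fdiff e 0%N / (Num.sqrt pi * 2 ^+ (m.*2 + a) * m`!%:R).
pose q := \sum_(m < N) c m *: herm (m.*2 + a) : {poly R}.
have sq : subgauss (fun x => q.[x] * gauss2 x).
  by apply: subgaussM; [exact: subexp_horner|exact: subgauss_gauss2].
pose g x := f x - q.[x] * gauss2 x.
have sg : subgauss g by exact: subgaussB.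
have spi0 : Num.sqrt pi != 0 :> R by rewrite gt_eqF // sqrtr_gt0 pi_gt0.
have mq j : moment_scale a j * gmean (q * 'X^(j.*2 + a)) = e j.
  (* Both cutoffs are harmless: terms beyond N vanish by the choice of N, and
     terms beyond j because the binomial does. *)
  rewrite (@newton e (N + j.+1)) ?ltn_addl // big_split_ord /=.
  rewrite [X in _ = _ + X]big1 ?addr0 => [|i _]; last by rewrite hN ?mulr0 // leq_addr.
  have -> : gmean (q * 'X^(j.*2 + a)) =
      \sum_(m < N) c m * gmean (herm (m.*2 + a) * 'X^(j.*2 + a)).
    rewrite /q mulr_suml; elim/big_rec2 : _ => [|i y1 y2 _ <-]; first exact: gmean0.
    by rewrite gmeanD -scalerAl gmeanZ.
  rewrite mulr_sumr; apply: eq_bigr => m _; rewrite mulrCA herm_moment /c.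
  by field; rewrite pnatr_eq0 -lt0n fact_gt0 expf_neq0 // spi0.
have zero j : Int (fun x => x ^+ (j.*2 + a) * (gauss2 x * g x)) = 0.
  have s1 : subgauss (fun x => x ^+ (j.*2 + a) * w x).
    by apply: subgaussM; [exact: subexp_pow|apply: subgaussM => //; exact: subexp_gauss2].
  have nu0 : moment_scale a j != 0 :> R.
    by rewrite gt_eqF // divr_gt0 ?mulr_gt0 ?exprn_gt0 // ltr0n fact_gt0.
  apply: (mulfI nu0); rewrite mulr0.
  have -> : Int (fun x => x ^+ (j.*2 + a) * (gauss2 x * g x)) =
      Int (fun x => x ^+ (j.*2 + a) * w x) - gmean (q * 'X^(j.*2 + a)).
    rewrite -IntB //; last exact: subgauss_horner_gauss.
    by apply: eq_Int => x; rewrite hornerM hornerXn /g /w /gauss; ring.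
  by rewrite mulrBr mq subrr.
have [p hp] := @Int_horner_trig_gauss2 q a.
exists (s / Num.sqrt (2 * pi) *: p) => x.
rewrite hornerZ -mulrA -hp {1}hf; congr (_ * _).
have : Int (fun y => trig a (x * y) * g y) = 0 by exact: moments_vanish.
have -> : (fun y => trig a (x * y) * g y) =
    (fun y => trig a (x * y) * f y - q.[y] * trig a (x * y) * gauss2 y).
  by apply/funext => y; rewrite /g; ring.
rewrite IntB.
- by move/eqP; rewrite subr_eq0 => /eqP.
- by apply: subgaussM => //; exact: subexp_trig.
- apply: subgaussM; last exact: subgauss_gauss2.
  by apply: subexpM; [exact: subexp_horner|exact: subexp_trig].
Qed.

End Hardy.

(** * Uniqueness of the Hermite functions *)

Section PolynomialGrowth.
Context {R : realType}.
Implicit Types p q : {poly R}.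

Lemma cvg_invr_pinfty : x^-1 @[x --> +oo] --> (0 : R).
Proof.
have h : \forall x \near +oo, 0 < (x : R) by exact: nbhs_pinfty_gt.
by apply/(gtr0_cvgV0 h); exact: cvg_id.
Qed.

Lemma cvg_invrX_pinfty k : (x ^+ k.+1)^-1 @[x --> +oo] --> (0 : R).
Proof.
elim: k => [|k IH].
  rewrite (_ : (fun x => _) = (fun x : R => x^-1)); first exact: cvg_invr_pinfty.
  by apply/funext => x; rewrite expr1.
rewrite (_ : (fun x => _) = (fun x : R => x^-1 * (x ^+ k.+1)^-1)).
  by rewrite -(mulr0 (0 : R)); apply: cvgM; [exact: cvg_invr_pinfty|exact: IH].
by apply/funext => x; rewrite exprS invfM.
Qed.

(** Peel off the constant coefficient: p = q X + c.  For k > 0 the term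
    c x^(-k) tends to 0, so the hypothesis passes to q with k - 1. *)
Lemma size_le_cvg p k : (x ^+ k)^-1 * p.[x] @[x --> +oo] --> (0 : R) -> (size p <= k)%N.
Proof.
have nz : \forall x \near +oo, (x : R) != 0.
  near=> x; rewrite gt_eqF //; near: x; exact: nbhs_pinfty_gt.
elim: k p => [|k IH] p.
  elim/poly_ind: p => [|q c IH] h; first by rewrite size_poly0.
  have q0 : q = 0.
    apply/eqP; rewrite -size_poly_leq0; apply: IH.
    have h2 : x^-1 * ((x ^+ 0)^-1 * (q * 'X + c%:P).[x]) - c * x^-1 @[x --> +oo] --> (0 * 0 - c * 0 : R).
      apply: cvgB; first by apply: cvgM h; exact: cvg_invr_pinfty.
      by apply: cvgMr; exact: cvg_invr_pinfty.
    rewrite !mulr0 subrr in h2; apply: cvg_trans h2; apply: near_eq_cvg.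
    near=> x; have x0 : x != 0 by near: x.
    by rewrite hornerMXaddC !expr0 !invr1 !mul1r; field.
  move: h; rewrite q0 mul0r add0r => h.
  have hc : (x ^+ 0)^-1 * (c%:P).[x] @[x --> +oo] --> (c : R).
    by apply: cvg_near_cst; near=> x; rewrite hornerC expr0 invr1 mul1r.
  by rewrite (cvg_unique _ hc h) ?size_poly0 // polyC0 size_poly0.
elim/poly_ind: p => [|q c _] h; first by rewrite size_poly0.
have sq : (size q <= k)%N.
  apply: IH.
  have h2 : (x ^+ k.+1)^-1 * (q * 'X + c%:P).[x] - c * (x ^+ k.+1)^-1 @[x --> +oo] --> (0 - c * 0 : R).
    by apply: cvgB h _; apply: cvgMr; exact: cvg_invrX_pinfty.
  rewrite mulr0 subrr in h2; apply: cvg_trans h2; apply: near_eq_cvg.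
  near=> x; have x0 : x != 0 by near: x.
  by rewrite hornerMXaddC exprS; field; rewrite x0 expf_neq0.
by rewrite size_MXaddC; case: ifP.
Unshelve. all: by end_near. Qed.

End PolynomialGrowth.

Section HermiteFunctions.
Context {R : realType}.
Implicit Types p q : {poly R}.

(** Rodrigues' formula. *)
Lemma derive1n_gauss n : derive1n n (fun y : R => expR (- y ^+ 2)) =
  fun x => (-1) ^+ n * (herm n).[x] * expR (- x ^+ 2).
Proof.
elim: n => [|n IH].
  by apply/funext => x; rewrite /= expr0 hornerC !mul1r.
rewrite /derive1n iterS -/(derive1n n _) IH; apply/funext => x; rewrite derive1E.
have h1 : is_derive x 1 (fun y : R => expR (- y ^+ 2)) (- (2 * x) * expR (- x ^+ 2)).
  have h0 : is_derive x 1 (fun y : R => - y ^+ 2) (- (2 * x)).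
    by apply: is_derive_eq; rewrite /GRing.scale /=; ring.
  have := @is_derive1_comp _ expR (fun y => - y ^+ 2) x _ _ (is_derive_expR _) h0.
  by rewrite mulrC.
have h2 := is_derive_scale ((-1) ^+ n) (is_derive_poly (herm n) x).
have := is_deriveM h2 h1; case=> _ h3.
apply: etrans h3 _; rewrite /GRing.scale /= hornerD hornerN hornerZ hornerM hornerX (exprS (-1)).
ring.
Qed.

Definition hnorm n : R := (Num.sqrt (Num.sqrt pi * 2 ^+ n * n`!%:R))^-1.

Lemma hnorm_arg_gt0 n : 0 < Num.sqrt pi * 2 ^+ n * n`!%:R :> R.
Proof. by rewrite !mulr_gt0 ?sqrtr_gt0 ?pi_gt0 ?exprn_gt0 ?ltr0n ?fact_gt0. Qed.

Lemma hnorm_gt0 n : 0 < hnorm n.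
Proof. by rewrite invr_gt0 sqrtr_gt0 hnorm_arg_gt0. Qed.

Lemma hnorm_sqr n : hnorm n ^+ 2 * (Num.sqrt pi * 2 ^+ n * n`!%:R) = 1.
Proof. by rewrite exprVn sqr_sqrtr ?ltW ?hnorm_arg_gt0 // mulVf // gt_eqF // hnorm_arg_gt0. Qed.

Lemma hermite_functionE n (x : R) :
  hermite_function n x = (hnorm n *: herm n).[x] * gauss2 x.
Proof.
rewrite /hermite_function derive1n_gauss hornerZ -/(hnorm n).
have -> : (-1) ^+ n * hnorm n * expR (x ^+ 2 / 2) *
    ((-1) ^+ n * (herm n).[x] * expR (- x ^+ 2)) =
  ((-1) ^+ n * (-1) ^+ n) * (hnorm n * (herm n).[x]) * (expR (x ^+ 2 / 2) * expR (- x ^+ 2)) by ring.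
rewrite -exprMn mulrNN mulr1 expr1n mul1r -expRD /gauss2; congr (_ * expR _); lra.
Qed.

(** Subtract from [P n] the multiple of [herm n] with the same coefficient in degree
    n.  The remainder r has degree d < n and is orthogonal to [P d], hence to
    [herm d]; but pairing with [herm d] reads off the leading coefficient of
    r ([gmean_herm_top]), so r = 0. *)
Lemma orthonormal_herm (P : nat -> {poly R}) :
  (forall n, (size (P n) <= n.+1)%N) ->
  (forall n m, gmean (P n * P m) = (n == m)%:R) ->
  forall n, P n = hnorm n *: herm n \/ P n = - (hnorm n *: herm n).
Proof.
move=> sP oP; elim/ltn_ind => n IH.
pose h := hnorm n *: herm n : {poly R}.
have [sh lh] := @size_lead_herm R n.
have hn : (herm n)`_n = 2 ^+ n :> R by rewrite -lh lead_coefE sh.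
have cn0 : hnorm n != 0 by rewrite gt_eqF // hnorm_gt0.
have p2 : 2 ^+ n != 0 :> R by rewrite expf_neq0.
pose c := (P n)`_n / (hnorm n * 2 ^+ n).
pose r := P n - c *: h.
have sr : (size r <= n)%N.
  apply/leq_sizeP => j; rewrite leq_eqVlt => /predU1P[<-|nj].
    by rewrite coefB !coefZ hn /c; field; rewrite cn0 p2.
  rewrite coefB !coefZ !nth_default ?mulr0 ?subrr // ?sh //.
  exact: leq_trans (sP n) _.
have r0 : r = 0.
  apply/eqP; rewrite -size_poly_eq0 -leqn0 leqNgt; apply/negP => s0.
  have [d dE] : exists d, size r = d.+1 by exists (size r).-1; rewrite prednK.
  have dn : (d < n)%N by rewrite -dE.
  have [sd ld] := @size_lead_herm R d.
  have : gmean (herm d * r) = r`_d * d`!%:R * Num.sqrt pi.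
    by apply: gmean_herm_top; rewrite dE.
  have -> : gmean (herm d * r) = 0.
    rewrite /r mulrBr gmeanB -!scalerAr !gmeanZ.
    rewrite [herm d * herm n]mulrC (@gmean_herm_top _ n (herm d)) ?sd 1?ltnW //.
    rewrite nth_default ?sd // !mul0r !mulr0 subr0.
    have cd0 : hnorm d != 0 by rewrite gt_eqF // hnorm_gt0.
    have dn0 : gmean (P d * P n) = 0 by rewrite oP (ltn_eqF dn).
    have : hnorm d * gmean (herm d * P n) = 0.
      rewrite -gmeanZ scalerAl; have [e|e] := IH d dn; first by rewrite -e.
      by rewrite -[hnorm d *: _]opprK -e mulNr -scaleN1r gmeanZ dn0 mulr0.
    by move/eqP; rewrite mulf_eq0 (negbTE cd0) => /eqP.
  move/esym/eqP; apply/negP; rewrite !mulf_neq0 ?pnatr_eq0 -?lt0n ?fact_gt0 //.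
    have -> : r`_d = lead_coef r by rewrite lead_coefE dE.
    by rewrite lead_coef_eq0 -size_poly_eq0 dE.
  by rewrite gt_eqF // sqrtr_gt0 pi_gt0.
have Pn : P n = c *: h by apply/eqP; rewrite -subr_eq0; apply/eqP.
have hh : gmean (h * h) = 1.
  rewrite /h -scalerAl -scalerAr !gmeanZ gmean_herm_top ?sh // hn mulrA -expr2.
  rewrite -[RHS](hnorm_sqr n); ring.
have := oP n n; rewrite eqxx Pn -scalerAl -scalerAr !gmeanZ hh mulr1 -expr2 => /eqP.
rewrite sqrf_eq1 => /orP[] /eqP ->; [left|right]; first by rewrite scale1r.
by rewrite scaleN1r.
Qed.

End HermiteFunctions.

(** * Eigenfunctions of the Fourier transform *)

Section FourierEigenfunctions.
Context {R : realType}.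
Local Notation mu := (@lebesgue_measure R).
Implicit Types f : R -> R.

Lemma tail_bound f k :
  x ^- k * expR (x ^+ 2 / 2) * f x @[x --> +oo] --> (0 : R) ->
  x ^- k * expR (x ^+ 2 / 2) * f x @[x --> -oo] --> (0 : R) ->
  exists A : R, 0 < A /\ forall x, A < `|x| -> `|f x| <= `|x| ^+ k * gauss2 x.
Proof.
move=> /cvgr0_norm_le/(_ 1 ltr01)[A [_ hA]] /cvgr0_norm_le/(_ 1 ltr01)[B [_ hB]].
have key (x : R) : x != 0 -> `|x ^- k * expR (x ^+ 2 / 2) * f x| <= 1 ->
    `|f x| <= `|x| ^+ k * gauss2 x.
  move=> x0; rewrite !normrM normfV normrX (ger0_norm (expR_ge0 _)) => h.
  have xk : 0 < `|x| ^+ k by rewrite exprn_gt0 // normr_gt0.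
  have -> : `|f x| = (`|x| ^+ k * gauss2 x) * ((`|x| ^+ k)^-1 * expR (x ^+ 2 / 2) * `|f x|).
    rewrite /gauss2 expRN; field.
    by rewrite ?(gt_eqF (expR_gt0 _)) ?expf_neq0 ?normr_eq0.
  by apply: ler_piMr => //; rewrite mulr_ge0 ?(ltW xk) ?expR_ge0.
exists (1 + `|A| + `|B|); split.
  by have := normr_ge0 A; have := normr_ge0 B; lra.
move=> x hx; have x0 : x != 0.
  by rewrite -normr_gt0 (le_lt_trans _ hx) // !addr_ge0.
apply: key => //; have [xpos|xneg] := lerP 0 x.
  apply: hA; rewrite (ger0_norm xpos) in hx; apply: le_lt_trans hx.
  have := ler_norm A; have := normr_ge0 B; lra.
apply: hB; rewrite (ltr0_norm xneg) in hx.
have := ler_norm (- B); rewrite normrN; have := normr_ge0 A; lra.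
Qed.

(** |f| <= 1 + f^2 on [-A, A]. *)
Lemma integrable_tail f k (A : R) : measurable_fun setT f ->
  mu.-integrable setT (EFin \o (fun x => f x ^+ 2)) ->
  (forall x, A < `|x| -> `|f x| <= `|x| ^+ k * gauss2 x) ->
  mu.-integrable setT (EFin \o f).
Proof.
move=> mf i2 hf.
pose w x := f x ^+ 2 + \1_(`[- A, A]%classic) x + `|x| ^+ k * gauss2 x.
have ig : mu.-integrable setT (EFin \o (fun x : R => `|x| ^+ k * gauss2 x)).
  apply: subgauss_integrable; apply: subgaussM; last exact: subgauss_gauss2.
  by apply: subexpX; apply: subexp_norm; exact: subexp_id.
apply: (@integrable_dom _ f w) => //.
  have := integrableD measurableT (integrableD measurableT i2 (integrable_indic_itv (- A) A true false)) ig.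
  by apply: eq_integrable.
move=> x; rewrite /w indicE.
have g0 : 0 <= `|x| ^+ k * gauss2 x by rewrite mulr_ge0 ?exprn_ge0 ?expR_ge0.
have [Ax|xA] := ltP A `|x|.
  apply: le_trans (hf x Ax) _; rewrite lerDr addr_ge0 ?sqr_ge0 //.
have -> : x \in `[- A, A]%classic.
  by rewrite inE /= in_itv /= -ler_norml.
rewrite -(real_normK (num_real (f x))) /=.
have := sqr_ge0 (`|f x| - 1); have := sqr_ge0 `|f x|; nra.
Qed.

(** On [-A, A] the function [gauss2] is bounded below by e^(-A^2/2). *)
Lemma gauss2_growth f k (A B : R) : 0 < A -> (forall x, `|f x| <= B) ->
  (forall x, A < `|x| -> `|f x| <= `|x| ^+ k * gauss2 x) ->
  forall x, `|f x| <= (1 + B * expR (A ^+ 2 / 2)) * (1 + x ^+ 2) ^+ k * gauss2 x.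
Proof.
move=> A0 fB fA x.
have B0 : 0 <= B := le_trans (normr_ge0 _) (fB 0).
have e0 : 0 <= B * expR (A ^+ 2 / 2) by rewrite mulr_ge0 ?expR_ge0.
have x2 : 1 <= 1 + x ^+ 2 by rewrite lerDl sqr_ge0.
have xk : 1 <= (1 + x ^+ 2) ^+ k by rewrite exprn_ege1.
have g0 : 0 < gauss2 x by exact: expR_gt0.
have [Ax|xA] := ltP A `|x|.
  apply: le_trans (fA x Ax) _; rewrite ler_wpM2r ?(ltW g0) //.
  apply: (@le_trans _ _ ((1 + x ^+ 2) ^+ k)).
    apply: lerXn2r; rewrite ?nnegrE ?addr_ge0 ?sqr_ge0 //.
    rewrite -(real_normK (num_real x)).
    have := sqr_ge0 (`|x| - 1); have := sqr_ge0 `|x|; nra.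
  by rewrite ler_peMl ?lerDl // (le_trans ler01).
apply: le_trans (fB x) _.
apply: (@le_trans _ _ (B * expR (A ^+ 2 / 2) * gauss2 x)).
  rewrite -mulrA ler_peMr // /gauss2 -expRD -expR0 ler_expR subr_ge0.
  rewrite ler_pM2r ?invr_gt0 // -(real_normK (num_real x)).
  by apply: lerXn2r; rewrite ?nnegrE ?(ltW A0).
rewrite ler_wpM2r ?(ltW g0) //; nra.
Qed.

Lemma integrable_trig f a (x : R) : measurable_fun setT f ->
  mu.-integrable setT (EFin \o f) ->
  mu.-integrable setT (EFin \o (fun y => trig a (x * y) * f y)).
Proof.
move=> mf fi; apply: (@integrable_dom _ _ (fun y => `|f y|)).
- exact: integrable_norm.
- apply: measurable_funM => //; have [+ _] : subexp (fun y : R => trig a (x * y)).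
    by case: a; [exact: subexp_sin|exact: subexp_cos].
  by [].
- by move=> y; rewrite normrM ler_piMl // norm_trig_le1.
Qed.

Lemma fourierE f (x : R) : measurable_fun setT f ->
  mu.-integrable setT (EFin \o f) ->
  fourier (fun y : R => (f y)%:C) x =
  (Num.sqrt (2 * pi))^-1 * Int (fun y => trig false (x * y) * f y) +i*
  (- ((Num.sqrt (2 * pi))^-1 * Int (fun y => trig true (x * y) * f y))).
Proof.
move=> mf fi.
have e (y : R) : cexp (- 'i%C * x%:C * y%:C) * (f y)%:C =
    (trig false (x * y) * f y) +i* (- 1 * (trig true (x * y) * f y)).
  by rewrite /cexp; simpc => /=; rewrite expR0 !mul1r cosN sinN mulNr.
rewrite /fourier /cintegral; under eq_Rintegral do rewrite e.
under [X in _ +i* X]eq_Rintegral do rewrite e.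
have -> : \int[mu]_y (- 1 * (trig true (x * y) * f y)) = - Int (fun y => trig true (x * y) * f y).
  by rewrite RintegralZl ?mulN1r //; exact: integrable_trig.
by rewrite /Int; simpc.
Qed.

(** Since [f] is real, only the real part (n even) or the imaginary part (n odd) of
    the transform survives, and (-i)^n = (-1)^(n/2) (-i)^(n mod 2). *)
Lemma fourier_eigen_trig f n : measurable_fun setT f ->
  mu.-integrable setT (EFin \o f) ->
  (forall x, fourier (fun y : R => (f y)%:C) x = (- 'i%C) ^+ n * (f x)%:C) ->
  forall x, f x = (-1) ^+ n./2 / Num.sqrt (2 * pi) * Int (fun y => trig (odd n) (x * y) * f y).
Proof.
move=> mf fi hf x; have := hf x; rewrite fourierE //.
have -> : (- 'i%C) ^+ n = (- 'i%C) ^+ odd n * ((-1) ^+ n./2)%:C :> R[i].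
  rewrite -[in LHS](odd_double_half n) exprD -mul2n exprM sqrrN.
  by rewrite sqr_i rmorphXn /= rmorphN1.
set s := (-1) ^+ n./2.
have s2 : s * s = 1 by rewrite /s -exprMn mulrNN mulr1 expr1n.
case: (odd n) => /=; rewrite ?expr1 ?expr0; simpc => /= -[h1 h2].
  by rewrite -mulrA (oppr_inj h2) mulrA s2 mul1r.
by rewrite -mulrA h1 mulrA s2 mul1r.
Qed.

Lemma trig_eigen_bounded f a (c : R) : measurable_fun setT f ->
  mu.-integrable setT (EFin \o f) ->
  (forall x, f x = c * Int (fun y => trig a (x * y) * f y)) ->
  exists B, forall x, `|f x| <= B.
Proof.
move=> mf fi hf; exists (`|c| * Int (fun y => `|f y|)) => x.
have it := integrable_trig a x mf fi.
rewrite hf normrM ler_wpM2l //; apply: le_trans (le_normr_Rintegral _ it) _ => //.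
apply: le_Rintegral => //; [exact: integrable_norm|exact: integrable_norm|].
by move=> y _; rewrite normrM ler_piMl // norm_trig_le1.
Qed.

Lemma fourier_eigen_poly f n : f \in Lfun mu 2%:E ->
  (forall x, fourier (fun y : R => (f y)%:C) x = (- 'i%C) ^+ n * (f x)%:C) ->
  x ^- n.+1 * expR (x ^+ 2 / 2) * f x @[x --> +oo] --> (0 : R) ->
  x ^- n.+1 * expR (x ^+ 2 / 2) * f x @[x --> -oo] --> (0 : R) ->
  exists2 p : {poly R}, (size p <= n.+1)%N & forall x, f x = p.[x] * gauss2 x.
Proof.
move=> f2 hF hp hm.
have mf : measurable_fun setT f by have := sub_Lfun_mfun f2; rewrite inE.
have [A [A0 hA]] := tail_bound hp hm.
have fi := integrable_tail mf (Lfun2_integrable_sqr f2) hA.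
have ht := fourier_eigen_trig mf fi hF.
have [B hB] := trig_eigen_bounded mf fi ht.
have B0 : 0 <= B := le_trans (normr_ge0 _) (hB 0).
have [//|//|p hp'] := hardy_eigenfunction _ _ mf (gauss2_growth A0 hB hA) ht.
- by rewrite sqrr_sign.
- by rewrite addr_ge0 ?mulr_ge0 ?expR_ge0.
exists p => //; apply: size_le_cvg; move: hp; set F := (X in X @ _ --> _).
suff -> : F = (fun x => (x ^+ n.+1)^-1 * p.[x]) by [].
apply/funext => x; rewrite /F hp' /gauss2 expRN mulrACA mulfV ?mulr1 //.
by rewrite gt_eqF ?expR_gt0.
Qed.

End FourierEigenfunctions.

Theorem theorem1p1 (R : realType) (f : nat -> R -> R)
  (f_fourier : forall (n : nat) (x : R),
     fourier (fun y : R => (f n y)%:C) x = (- 'i%C) ^+ n * (f n x)%:C)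
  (f_L2 : forall n : nat, f n \in Lfun (@lebesgue_measure R) 2%:E)
  (f_orthonormal : forall n m : nat,
     (\int[@lebesgue_measure R]_x (f n x * f m x)%:E)%E = ((n == m)%:R)%:E)
  (f_decay : forall n : nat,
     (x ^- n.+1 * expR (x ^+ 2 / 2) * f n x @[x --> +oo] --> (0 : R)) /\
     (x ^- n.+1 * expR (x ^+ 2 / 2) * f n x @[x --> -oo] --> (0 : R))) :
  forall n : nat,
    (forall x : R, f n x = hermite_function n x) \/
    (forall x : R, f n x = - hermite_function n x).
Proof.
have fP n : exists p : {poly R}, (size p <= n.+1)%N /\ forall x, f n x = p.[x] * gauss2 x.
  have [hp hm] := f_decay n.
  by have [p sp fp] := fourier_eigen_poly (f_L2 n) (f_fourier n) hp hm; exists p.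
have [P /all_and2[sP fPE]] := choice fP.
have oP n m : gmean (P n * P m) = (n == m)%:R.
  rewrite -[RHS]/(fine ((n == m)%:R)%:E) -f_orthonormal /gmean /Int /Rintegral.
  by congr fine; apply: eq_integral => x _; rewrite hornerM !fPE /gauss; congr EFin; ring.
move=> n; have [hP|hP] := orthonormal_herm sP oP n; [left|right] => x;
  by rewrite fPE hP hermite_functionE ?hornerN ?mulNr.
Qed.
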